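(* Let $N\ge1$ be an integer and let $\mathrm{BS}(N,N)=\langle a,b\mid a^N b=b a^N\rangle$. The generating function $[q^0]G(z;q)=\sum_{n\ge0}g_{n,0}z^n$, where $g_{n,0}$ is the number of words of length $n$ in the letters $a,a^{-1},b,b^{-1}$ (not necessarily freely reduced) that represent the identity of $\mathrm{BS}(N,N)$, is D-finite, that is, it satisfies a nontrivial linear differential equation with polynomial coefficients. Furthermore, the cogrowth series $\sum_{n\ge0}c(n)t^n$, where $c(n)$ is the number of freely reduced words of length $n$ in $a^{\pm1},b^{\pm1}$ that represent the identity of $\mathrm{BS}(N,N)$, is also D-finite. It follows that the cogrowth of $\mathrm{BS}(N,N)$ (with respect to the generators $a,b$) is an algebraic number.
   Context: A word is freely reduced if it contains no subword of the form $xx^{-1}$ with $x$ a generator or the inverse of a generator. The cogrowth of a group with respect to a finite generating set is the exponential growth rate $\limsup_{n\to\infty}c(n)^{1/n}$, where $c(n)$ is the number of freely reduced words of length $n$ in the generators and their inverses that represent the identity. *)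

(* Defs.v *)
From HB Require Import structures.
From mathcomp Require Import all_boot all_order all_algebra.
From mathcomp Require Import all_classical all_reals all_analysis.

Set Implicit Arguments.
Unset Strict Implicit.
Unset Printing Implicit Defensive.

Import Order.TTheory GRing.Theory Num.Theory.
Import numFieldNormedType.Exports.

Local Open Scope ring_scope.

(* [(s, false)] is the generator [s] and [(s, true)] is its inverse. *)
Definition letter (S : Type) : Type := (S * bool)%type.

Definition inv_letter (S : Type) (x : letter S) : letter S := (x.1, ~~ x.2).

(* Equality of words in the group with generating set [S] and defining
   relations [u = v] for [rel u v]: the least congruence on the free monoid
   over the letters that contains the relations and makes [x] and
   [inv_letter x] mutually inverse. *)
Inductive presented_eq (S : Type) (rel : seq (letter S) -> seq (letter S) -> Prop) :
    seq (letter S) -> seq (letter S) -> Prop :=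
| presented_rel u v : rel u v -> presented_eq rel u v
| presented_inv x : presented_eq rel [:: x; inv_letter x] [::]
| presented_refl u : presented_eq rel u u
| presented_sym u v : presented_eq rel u v -> presented_eq rel v u
| presented_trans u v w :
    presented_eq rel u v -> presented_eq rel v w -> presented_eq rel u w
| presented_cat u u' v v' :
    presented_eq rel u u' -> presented_eq rel v v' ->
    presented_eq rel (u ++ v) (u' ++ v').

Definition represents_identity (S : Type)
    (rel : seq (letter S) -> seq (letter S) -> Prop) (w : seq (letter S)) : Prop :=
  presented_eq rel w [::].

Definition freely_reduced (S : eqType) (w : seq (letter S)) : bool :=
  sorted (fun x y => y != inv_letter x) w.

Definition count_identity (S : finType)
    (rel : seq (letter S) -> seq (letter S) -> Prop) (n : nat) : nat :=
  #|[set w : n.-tuple (letter S) | `[< represents_identity rel w >]]|.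

Definition count_reduced_identity (S : finType)
    (rel : seq (letter S) -> seq (letter S) -> Prop) (n : nat) : nat :=
  #|[set w : n.-tuple (letter S) |
      freely_reduced w && `[< represents_identity rel w >]]|.

Definition cogrowth (R : realType) (S : finType)
    (rel : seq (letter S) -> seq (letter S) -> Prop) : \bar R :=
  limn_esup (fun n : nat =>
    (((count_reduced_identity rel n)%:R : R) `^ (n%:R^-1))%:E).

Inductive bs_gen : Set := bs_a | bs_b.

Definition bool_of_bs_gen (s : bs_gen) : bool :=
  match s with bs_a => false | bs_b => true end.

Definition bs_gen_of_bool (t : bool) : bs_gen := if t then bs_b else bs_a.

Lemma bool_of_bs_genK : cancel bool_of_bs_gen bs_gen_of_bool.
Proof. by case. Qed.

HB.instance Definition _ := Finite.copy bs_gen (can_type bool_of_bs_genK).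

(* The single defining relation a^N b = b a^N of BS(N,N). *)
Inductive bs_rel (N : nat) : seq (letter bs_gen) -> seq (letter bs_gen) -> Prop :=
| BsRel : bs_rel N (rcons (nseq N (bs_a, false)) (bs_b, false))
                   ((bs_b, false) :: nseq N (bs_a, false)).

(* A formal power series is given by its sequence of coefficients. *)
Definition fps_deriv (F : fieldType) (f : nat -> F) : nat -> F :=
  fun n => f n.+1 *+ n.+1.

Definition poly_mul_fps (F : fieldType) (p : {poly F}) (f : nat -> F) : nat -> F :=
  fun n => \sum_(j < n.+1) p`_j * f (n - j)%N.

Definition D_finite (F : fieldType) (f : nat -> F) : Prop :=
  exists (d : nat) (p : 'I_d.+1 -> {poly F}),
    (exists i, p i != 0) /\
    forall n, \sum_(i < d.+1) poly_mul_fps (p i) (iter i (@fps_deriv F) f) n = 0.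

(* Main.v *)
(** Let [Q = Z/N * Z] be the quotient of BS(N,N) by its central subgroup
    [<a^N>].  A word represents the identity iff it is trivial in [Q] and has
    exponent sum [0] in [a].  Walks on [Q], with weights [t u^2], [t], [t u]
    for [a], [a^-1], [b^{+-1}], have a Green function in [Q[u][[t]]] that can
    be written down explicitly along the tree-like normal forms of [Q], in terms
    of the generating function of first passages from [b] to [1]; the latter
    is a root of a polynomial built from Chebyshev polynomials.  Replacing
    [1 - tS] by [1 + 3 z^2 - tS] (with [z = t u] and [S] the sum of the
    letters) and multiplying by [1 - z^2] gives the reduced words instead.

    The sequence wanted is the diagonal, i.e. the coefficients of [t^n u^n].
    It is D-finite by Lipshitz's argument: counting dimensions, an algebraic
    series is annihilated by some nonzero operator in [z], [d/dz], [d/dq] (here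
    [q = u] and [z] is kept constant in [d/dq]) not involving [q], and taking
    residues in [q] kills all terms that contain [d/dq] on the left.

    Finally, a D-finite series with nonnegative coefficients and radius of
    convergence [r] is singular at [r], so that [r] is a root of the leading
    coefficient of the equation. *)

Require Import Defs.
From HB Require Import structures.
From mathcomp Require Import all_boot all_order all_algebra.
From mathcomp Require Import all_classical all_reals all_analysis.
From mathcomp Require Import ring lra zify.

Set Implicit Arguments.
Unset Strict Implicit.
Unset Printing Implicit Defensive.

Import Order.TTheory GRing.Theory Num.Theory.
Import numFieldNormedType.Exports.

Local Open Scope ring_scope.

(** * Formal power series *)

Definition fps (R : Type) : Type := nat -> R.

Section FpsRing.
Variable R : comNzRingType.
Implicit Types f g h : fps R.

HB.instance Definition _ := gen_eqMixin (fps R).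
HB.instance Definition _ := gen_choiceMixin (fps R).

Lemma fpsP f g : (forall n, f n = g n) -> f = g.
Proof. exact: funext. Qed.

Definition fps_add f g : fps R := fun n => f n + g n.
Definition fps_opp f : fps R := fun n => - f n.
Definition fps_zero : fps R := fun=> 0.

Fact fps_addA : associative fps_add.
Proof. by move=> f g h; apply: fpsP => n; exact: addrA. Qed.
Fact fps_addC : commutative fps_add.
Proof. by move=> f g; apply: fpsP => n; exact: addrC. Qed.
Fact fps_add0 : left_id fps_zero fps_add.
Proof. by move=> f; apply: fpsP => n; exact: add0r. Qed.
Fact fps_addN : left_inverse fps_zero fps_opp fps_add.
Proof. by move=> f; apply: fpsP => n; exact: addNr. Qed.

HB.instance Definition _ :=
  GRing.isZmodule.Build (fps R) fps_addA fps_addC fps_add0 fps_addN.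

Definition fps_mul f g : fps R := fun n => \sum_(i < n.+1) f i * g (n - i)%N.
Definition fps_const (c : R) : fps R := fun n => c *+ (n == 0%N).
(** Coefficients up to [m] of a product depend only on the truncations at [m], so the laws of the
    Cauchy product are inherited from polynomials. *)
Definition fps_trunc m f : {poly R} := \poly_(i < m.+1) f i.

Lemma coef_fps_trunc m f n : (n <= m)%N -> (fps_trunc m f)`_n = f n.
Proof. by move=> le_nm; rewrite coef_poly ltnS le_nm. Qed.

Lemma fps_mul_trunc m f g n :
  (n <= m)%N -> fps_mul f g n = (fps_trunc m f * fps_trunc m g)`_n.
Proof.
move=> le_nm; rewrite coefM; apply: eq_bigr => -[i /= lt_in] _.
by rewrite !coef_fps_trunc //; lia.
Qed.

Fact fps_mulC : commutative fps_mul.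
Proof. by move=> f g; apply: fpsP => n; rewrite !(fps_mul_trunc _ _ (leqnn n)) mulrC. Qed.

Fact fps_mulA : associative fps_mul.
Proof.
move=> f g h; apply: fpsP => n; rewrite /fps_mul.
have trE (p q : fps R) i : (i <= n)%N ->
  fps_mul p q i = (fps_trunc n p * fps_trunc n q)`_i by exact: fps_mul_trunc.
transitivity ((fps_trunc n f * (fps_trunc n g * fps_trunc n h))`_n).
  rewrite coefM; apply: eq_bigr => -[i /= lt_in] _.
  by rewrite coef_fps_trunc // -trE //; lia.
rewrite mulrA coefM; apply: eq_bigr => -[i /= lt_in] _.
by rewrite coef_fps_trunc ?leq_subr // -trE.
Qed.

Lemma fps_const_mulE c f n : fps_mul (fps_const c) f n = c * f n.
Proof.
rewrite /fps_mul big_ord_recl /= subn0 big1 ?addr0 // => i _.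
by rewrite /fps_const /= mulr0n mul0r.
Qed.

Fact fps_mul1 : left_id (fps_const 1) fps_mul.
Proof. by move=> f; apply: fpsP => n; rewrite fps_const_mulE mul1r. Qed.
Fact fps_mulDl : left_distributive fps_mul fps_add.
Proof.
move=> f g h; apply: fpsP => n.
by rewrite /fps_mul /fps_add -big_split; apply: eq_bigr => i _; rewrite mulrDl.
Qed.
Fact fps_1neq0 : fps_const 1 != 0.
Proof.
apply/eqP => /(congr1 (fun f => f 0%N)); rewrite /fps_const /= => /eqP.
by rewrite mulr1n (oner_eq0 R).
Qed.

HB.instance Definition _ := GRing.Zmodule_isComNzRing.Build (fps R)
  fps_mulA fps_mulC fps_mul1 fps_mulDl fps_1neq0.

Lemma fps0E n : (0 : fps R) n = 0. Proof. by []. Qed.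
Lemma fpsDE f g n : (f + g) n = f n + g n. Proof. by []. Qed.
Lemma fpsNE f n : (- f) n = - f n. Proof. by []. Qed.
Lemma fpsBE f g n : (f - g) n = f n - g n. Proof. by []. Qed.
Lemma fpsME f g n : (f * g) n = \sum_(i < n.+1) f i * g (n - i)%N.
Proof. by []. Qed.
Lemma fps1E : 1 = fps_const 1. Proof. by []. Qed.
Lemma fpsCM c f n : (fps_const c * f) n = c * f n.
Proof. exact: fps_const_mulE. Qed.
Lemma fpsM0 f g : (f * g) 0%N = f 0%N * g 0%N.
Proof. by rewrite fpsME big_ord1. Qed.
Lemma fps_sumE (I : Type) (r : seq I) (P : pred I) (F : I -> fps R) n :
  (\sum_(i <- r | P i) F i) n = \sum_(i <- r | P i) F i n.
Proof. by elim/big_rec2: _ => // i y x _ <-. Qed.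
Lemma fps_mulrnE f k n : (f *+ k) n = f n *+ k.
Proof. by elim: k => // k IH; rewrite !mulrS fpsDE IH. Qed.

Lemma fps_constD c d : fps_const (c + d) = fps_const c + fps_const d.
Proof. by apply: fpsP => n; rewrite fpsDE /fps_const mulrnDl. Qed.
Lemma fps_constN c : fps_const (- c) = - fps_const c.
Proof. by apply: fpsP => n; rewrite fpsNE /fps_const mulNrn. Qed.
Lemma fps_constM c d : fps_const (c * d) = fps_const c * fps_const d.
Proof. by apply: fpsP => n; rewrite fpsCM /fps_const mulrnAr. Qed.

Lemma fps_const_is_zmod : zmod_morphism fps_const.
Proof. by move=> c d; rewrite fps_constD fps_constN. Qed.
Lemma fps_const_is_monoid : monoid_morphism fps_const.
Proof. by split=> // c d; rewrite fps_constM. Qed.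
HB.instance Definition _ := GRing.isZmodMorphism.Build R (fps R) fps_const fps_const_is_zmod.
HB.instance Definition _ := GRing.isMonoidMorphism.Build R (fps R) fps_const fps_const_is_monoid.

Definition fps_t : fps R := fun n => (n == 1%N)%:R.

Lemma fps_tM0 f : (fps_t * f) 0%N = 0.
Proof. by rewrite fpsM0 mul0r. Qed.
Lemma fps_tMS f n : (fps_t * f) n.+1 = f n.
Proof.
rewrite fpsME 2!big_ord_recl /= mul0r add0r mul1r subSS subn0 big1 ?addr0 // => i _.
by rewrite mul0r.
Qed.

Lemma fps_tXME a f n : (fps_t ^+ a * f) n = if (a <= n)%N then f (n - a)%N else 0.
Proof.
elim: a n => [|a IH] n; first by rewrite mul1r subn0.
case: n => [|n]; first by rewrite exprS -mulrA fps_tM0.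
by rewrite exprS -mulrA fps_tMS IH.
Qed.

(** * Order of vanishing, Hensel's lemma and inverses *)

Definition fps_ord_ge k f := forall i, (i < k)%N -> f i = 0.

Lemma fps_ord_geD k f g : fps_ord_ge k f -> fps_ord_ge k g -> fps_ord_ge k (f + g).
Proof. by move=> Hf Hg i lt_ik; rewrite fpsDE Hf ?Hg ?addr0. Qed.
Lemma fps_ord_geN k f : fps_ord_ge k f -> fps_ord_ge k (- f).
Proof. by move=> Hf i lt_ik; rewrite fpsNE Hf ?oppr0. Qed.
Lemma fps_ord_geB k f g : fps_ord_ge k f -> fps_ord_ge k g -> fps_ord_ge k (f - g).
Proof. by move=> Hf Hg; exact/fps_ord_geD/fps_ord_geN. Qed.
Lemma fps_ord_geM k l f g :
  fps_ord_ge k f -> fps_ord_ge l g -> fps_ord_ge (k + l) (f * g).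
Proof.
move=> Hf Hg n lt_n; rewrite fpsME big1 // => -[i /= lt_in] _.
case: (ltnP i k) => [/Hf->|le_ki]; first by rewrite mul0r.
by rewrite Hg ?mulr0 //; lia.
Qed.
Lemma fps_ord_geMr k f g : fps_ord_ge k f -> fps_ord_ge k (f * g).
Proof. by move=> Hf; rewrite -(addn0 k); exact: fps_ord_geM. Qed.
Lemma fps_ord_ge1 f : fps_ord_ge 1 f <-> f 0%N = 0.
Proof. by split=> [->|f0 [|]]. Qed.

Lemma horner_fps0 (P : {poly (fps R)}) f : f 0%N = 0 -> P.[f] 0%N = P`_0 0%N.
Proof.
by move=> f0; elim/poly_ind: P => [|P c _]; rewrite ?horner0 ?coef0 //
  hornerMXaddC fpsDE fpsM0 f0 mulr0 add0r coefD coefMX coefC /= add0r.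
Qed.

(** Every term of [P.[f] - P.[g]] beyond the linear one is [f - g] times a series without constant
    term. *)
Lemma horner_fps_contract (P : {poly (fps R)}) k f g :
  f 0%N = 0 -> g 0%N = 0 -> fps_ord_ge k (f - g) ->
  fps_ord_ge k.+1 (P.[f] - P.[g] - P`_1 * (f - g)).
Proof.
move=> f0 g0 fg.
have ord_horner (Q : {poly (fps R)}) : fps_ord_ge k (Q.[f] - Q.[g]).
  elim/poly_ind: Q => [|Q c IH]; first by rewrite !horner0 subrr.
  rewrite !hornerMXaddC opprD addrACA subrr addr0.
  have ->: Q.[f] * f - Q.[g] * g = (Q.[f] - Q.[g]) * f + (f - g) * Q.[g] by ring.
  by apply: fps_ord_geD; exact: fps_ord_geMr.
elim/poly_ind: P => [|Q c _]; first by rewrite !horner0 coef0 mul0r !subrr.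
rewrite !hornerMXaddC coefD coefMX coefC /= addr0.
have ->: Q.[f] * f + c - (Q.[g] * g + c) - Q`_0 * (f - g) =
  (f - g) * (Q.[f] - Q`_0) + (Q.[f] - Q.[g]) * g by ring.
rewrite -addn1; apply: fps_ord_geD; apply: fps_ord_geM => //; last by apply/fps_ord_ge1.
by apply/fps_ord_ge1; rewrite fpsBE horner_fps0 ?subrr.
Qed.

(* Newton iteration [f |-> f - P(f)] gains one correct coefficient per step. *)
Lemma fps_hensel (P : {poly (fps R)}) :
  P`_0 0%N = 0 -> P`_1 0%N = 1 -> exists2 f : fps R, f 0%N = 0 & P.[f] = 0.
Proof.
move=> P0 P1; pose T (f : fps R) := f - P.[f]; pose s k := iter k T 0.
have s0 k : s k 0%N = 0.
  by elim: k => //= k IH; rewrite /T fpsBE horner_fps0 ?IH ?P0 ?subrr.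
have step (f g : fps R) k : f 0%N = 0 -> g 0%N = 0 ->
    fps_ord_ge k (f - g) -> fps_ord_ge k.+1 (T f - T g).
  move=> f0 g0 fg; have -> : T f - T g =
    (f - g) * (1 - P`_1) - (P.[f] - P.[g] - P`_1 * (f - g)) by rewrite /T; ring.
  apply: fps_ord_geB; last exact: horner_fps_contract.
  rewrite -addn1; apply: fps_ord_geM => //.
  by apply/fps_ord_ge1; rewrite fpsBE P1 subrr.
have sS k : fps_ord_ge k (s k.+1 - s k) by elim: k => [|k IH] //; exact: (step (s k.+1) (s k)).
have s_stab k j : fps_ord_ge k (s (k + j)%N - s k).
  elim: j => [|j IH]; first by rewrite addn0 subrr.
  rewrite addnS -(subrKA (s (k + j)%N)); apply: fps_ord_geD => // i lt_ik.
  by apply: sS; lia.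
(* The limit of the iteration: the coefficient of [t ^ n] is stable from step [n.+1] on. *)
pose f : fps R := fun n => s n.+1 n.
have fs k : fps_ord_ge k (f - s k).
  move=> i lt_ik; rewrite fpsBE /f.
  have := s_stab i.+1 (k - i.+1)%N i (ltnSn i).
  by rewrite subnKC // fpsBE => /eqP; rewrite subr_eq0 => /eqP ->; rewrite subrr.
have f0 : f 0%N = 0 by exact: s0.
exists f => //; apply: fpsP => n.
have := step f (s n) n f0 (s0 n) (fs n) n (ltnSn n).
have := fs n.+1 n (ltnSn n); rewrite fps0E.
rewrite /= -/(s n) /T !fpsBE => /eqP; rewrite subr_eq0 => /eqP ->.
by rewrite addrAC subrr sub0r => /eqP; rewrite oppr_eq0 => /eqP.
Qed.

Lemma fps_inv_exists f : f 0%N = 1 -> exists g : fps R, f * g = 1.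
Proof.
move=> f0; have [||g g0 /eqP Pg] := @fps_hensel (f%:P * (1 + 'X) - 1).
- by rewrite mulrDr mulr1 !coefD coefN coefMX coefC coef1 /= addr0 fpsBE f0 subrr.
- by rewrite mulrDr mulr1 !coefD coefN coefMX !coefC /= add0r subr0.
exists (1 + g); apply/eqP; move: Pg.
by rewrite !hornerE subr_eq0.
Qed.

End FpsRing.

Arguments fps_t {R}.

(** If [f] starts at [t ^ m] and [g] vanishes below [k], the coefficient of [t ^ (m + k)] in the
    product is [f m * g k]. *)
Lemma fps_mulf_eq0 (R : idomainType) (f g : fps R) : f != 0 -> f * g = 0 -> g = 0.
Proof.
move=> fN0 fg0.
have [n fn] : exists n, f n != 0.
  apply: contrapT => nf; case/eqP: fN0; apply: fpsP => n.
  by apply/eqP; apply: contraT => fn; case: nf; exists n.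
case: (ex_minnP (ex_intro (fun n => f n != 0) n fn)) => m fm m_min {n fn}.
have f_lt i : (i < m)%N -> f i = 0.
  by move=> lt_im; apply/eqP; apply: contraTT lt_im => /m_min; rewrite leqNgt.
apply: fpsP => k; elim/ltn_ind: k => k IH; apply/eqP.
have := congr1 (fun h : fps R => h (m + k)%N) fg0; rewrite fpsME fps0E.
have lt_m : (m < (m + k).+1)%N by lia.
rewrite (bigD1 (Ordinal lt_m)) //= addKn big1 ?addr0 => [/eqP|[i /= lt_i] /eqP neq_im].
  by rewrite mulf_eq0 (negPf fm).
have {}neq_im : i <> m by move=> eim; apply: neq_im; exact: val_inj.
case: (ltnP i m) => [/f_lt->|le_mi]; first by rewrite mul0r.
by rewrite IH ?mulr0 //; lia.
Qed.

(** * Diagonals of algebraic series *)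

Section Filtration.
Local Notation A := (fps {poly rat}).
Implicit Types (f g x mu : A) (s : seq A) (e : nat) (c : rat).

Definition fps_rat c : A := fps_const c%:P.
Definition fps_u : A := fps_const 'X.

(** The rational span of the products of at most [e] elements of [s]; the dimension count relies on
    the degree bound. *)
Inductive filt s : nat -> A -> Prop :=
| filt_rat c : filt s 0 (fps_rat c)
| filtD e f g : filt s e f -> filt s e g -> filt s e (f + g)
| filt_gen e x f : x \in s -> filt s e f -> filt s e.+1 (x * f)
| filt_weak e f : filt s e f -> filt s e.+1 f.

Lemma filt_le s e e' f : (e <= e')%N -> filt s e f -> filt s e' f.
Proof.
by move=> /subnK <-; elim: (e' - e)%N => // k IH /IH; exact: filt_weak.
Qed.

Lemma filt_sub s s' e f : {subset s <= s'} -> filt s e f -> filt s' e f.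
Proof.
move=> sub; elim=> [c|{}e {}f g _ IHf _ IHg|{}e x {}f xs _ IH|{}e {}f _ IH].
- exact: filt_rat.
- exact: filtD.
- by apply: filt_gen => //; exact: sub.
- exact: filt_weak.
Qed.

Lemma filt_ratM s e c f : filt s e f -> filt s e (fps_rat c * f).
Proof.
elim=> [d|{}e {}f g _ IHf _ IHg|{}e x {}f xs _ IH|{}e {}f _ IH].
- by rewrite -rmorphM -polyCM; exact: filt_rat.
- by rewrite mulrDr; exact: filtD.
- by rewrite mulrCA; exact: filt_gen.
- exact: filt_weak.
Qed.

Lemma filtM s e1 e2 f g : filt s e1 f -> filt s e2 g -> filt s (e1 + e2) (f * g).
Proof.
move=> Hf Hg; elim: Hf => [c|e {}f h _ IHf _ IHh|e x {}f xs _ IH|e {}f _ IH].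
- exact: filt_ratM.
- by rewrite mulrDl; exact: filtD.
- by rewrite -mulrA addSn; exact: filt_gen.
- by rewrite addSn; exact: filt_weak.
Qed.

Lemma filt0 s e : filt s e 0.
Proof. by apply: (@filt_le _ 0) => //; rewrite -(rmorph0 (fps_const (R := _))) -polyC0; exact: filt_rat. Qed.

Lemma filt1 s e : filt s e 1.
Proof. by apply: (@filt_le _ 0) => //; exact: (filt_rat s 1). Qed.

Lemma filtN s e f : filt s e f -> filt s e (- f).
Proof.
move=> /(filt_ratM (-1)); rewrite /fps_rat polyCN rmorphN /=.
by rewrite (rmorph1 (fps_const (R := _))) mulN1r.
Qed.

Lemma filtB s e f g : filt s e f -> filt s e g -> filt s e (f - g).
Proof. by move=> Hf Hg; exact/filtD/filtN. Qed.

Lemma filtMn s e f k : filt s e f -> filt s e (f *+ k).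
Proof. by move=> Hf; elim: k => [|k IH]; rewrite ?mulrS; [exact: filt0|exact: filtD]. Qed.

Lemma filt_mem s x : x \in s -> filt s 1 x.
Proof. by move=> xs; rewrite -(mulr1 x); apply: filt_gen => //; exact: filt1. Qed.

Lemma filtX s e f k : filt s e f -> filt s (k * e) (f ^+ k).
Proof.
move=> Hf; elim: k => [|k IH]; first exact: filt1.
by rewrite exprS mulSn; exact: filtM.
Qed.

(** This makes the elements of degree [e] in [t] and [u] a space of dimension at most
    [(e + 1) ^ 2]. *)
Lemma filt_tu_coef e f : filt [:: fps_t; fps_u] e f ->
  forall i j, (e < i)%N || (e < j)%N -> (f i)`_j = 0.
Proof.
elim=> [c|{}e {}f g _ IHf _ IHg|{}e x {}f xs _ IH|{}e {}f _ IH] i j lt_ij.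
- by rewrite /fps_rat /fps_const coefMn coefC; case: i lt_ij => [|i] //=; case: j.
- by rewrite fpsDE coefD IHf ?IHg ?addr0.
- move: xs; rewrite !inE => /orP[] /eqP ->.
    by case: i lt_ij => [|i] lt_ij; rewrite ?fps_tM0 ?coef0 // fps_tMS IH //; lia.
  by rewrite fpsCM coefXM; case: j lt_ij => //= j lt_ij; rewrite IH //; lia.
- by apply: IH; lia.
Qed.

Definition gen_by s f := exists e, filt s e f.

Lemma gen_by_rat s c : gen_by s (fps_rat c).
Proof. by exists 0%N; exact: filt_rat. Qed.
Lemma gen_by0 s : gen_by s 0. Proof. by exists 0%N; exact: filt0. Qed.
Lemma gen_by1 s : gen_by s 1. Proof. by exists 0%N; exact: filt1. Qed.
Lemma gen_by_mem s x : x \in s -> gen_by s x.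
Proof. by exists 1%N; exact: filt_mem. Qed.
Lemma gen_byD s f g : gen_by s f -> gen_by s g -> gen_by s (f + g).
Proof.
move=> [e Hf] [e' Hg]; exists (maxn e e').
by apply: filtD; [apply: filt_le Hf|apply: filt_le Hg]; lia.
Qed.
Lemma gen_byN s f : gen_by s f -> gen_by s (- f).
Proof. by move=> [e Hf]; exists e; exact: filtN. Qed.
Lemma gen_byB s f g : gen_by s f -> gen_by s g -> gen_by s (f - g).
Proof. by move=> Hf Hg; exact/gen_byD/gen_byN. Qed.
Lemma gen_byM s f g : gen_by s f -> gen_by s g -> gen_by s (f * g).
Proof. by move=> [e Hf] [e' Hg]; exists (e + e')%N; exact: filtM. Qed.
Lemma gen_byX s f k : gen_by s f -> gen_by s (f ^+ k).
Proof. by move=> [e Hf]; exists (k * e)%N; exact: filtX. Qed.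
Lemma gen_byMn s f k : gen_by s f -> gen_by s (f *+ k).
Proof. by move=> [e Hf]; exists e; exact: filtMn. Qed.
Lemma gen_by_sub s s' f : {subset s <= s'} -> gen_by s f -> gen_by s' f.
Proof. by move=> sub [e Hf]; exists e; exact: filt_sub Hf. Qed.

Definition derivation (D : A -> A) :=
  [/\ {morph D : f g / f + g}, forall f g, D (f * g) = D f * g + f * D g
    & forall c, D (fps_rat c) = 0].

Lemma derivation0 D : derivation D -> D 0 = 0.
Proof.
by move=> [_ _ /(_ 0)]; rewrite /fps_rat polyC0 (rmorph0 (fps_const (R := _))).
Qed.

Lemma derivationX D F j : derivation D ->
  F * D (F ^+ j) = (F ^+ j * D F) *+ j.
Proof.
move=> [_ DM Dc]; elim: j => [|j IH].
  by rewrite mulr0n expr0 (_ : 1 = fps_rat 1) ?Dc ?mulr0.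
rewrite exprS DM mulrDr IH mulrS mulrnAr -!mulrA; congr (_ + _).
by rewrite [D F * _]mulrC.
Qed.

(** Here [F] is a common denominator for the derivatives of the generators. A term of the Leibniz
    rule differentiates one generator only, so the degree grows by [K], whatever [e] is. *)
Lemma filt_derivation s D F K e f : derivation D -> filt s K F ->
  (forall x, x \in s -> filt s K (F * D x)) ->
  filt s e f -> filt s (e + K) (F * D f).
Proof.
move=> [DD DM Dc] HF Hx.
elim=> [c|{}e {}f g _ IHf _ IHg|{}e x {}f xs Hf IH|{}e {}f _ IH].
- by rewrite Dc mulr0; exact: filt0.
- by rewrite DD mulrDr; exact: filtD.
- rewrite DM mulrDr; apply: filtD.
    rewrite mulrA; apply: (@filt_le _ (K + e)); first by lia.
    by apply: filtM => //; exact: Hx.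
  by rewrite mulrCA addSn; exact: filt_gen.
- exact: filt_weak.
Qed.

(** The Euler operators [t d/dt] and [u d/du], which act diagonally on monomials. *)
Definition fps_theta f : A := fun n => f n *+ n.
Definition fps_eta f : A := fun n => 'X * (f n)^`().

Lemma fps_theta_derivation : derivation fps_theta.
Proof.
split=> [f g|f g|c]; apply: fpsP => n.
- by rewrite /fps_theta !fpsDE mulrnDl.
- rewrite fpsDE !fpsME /fps_theta fpsME -sumrMnl -big_split /=.
  apply: eq_bigr => -[i /= lt_in] _.
  by rewrite mulrnAl mulrnAr -mulrnDr subnKC.
- by rewrite /fps_theta /fps_rat /fps_const -mulrnA; case: n.
Qed.

Lemma fps_eta_derivation : derivation fps_eta.
Proof.
split=> [f g|f g|c]; apply: fpsP => n.
- by rewrite /fps_eta !fpsDE derivD mulrDr.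
- rewrite fpsDE !fpsME /fps_eta fpsME raddf_sum mulr_sumr -big_split /=.
  by apply: eq_bigr => i _; rewrite derivM; ring.
- by rewrite /fps_eta /fps_rat /fps_const derivMn derivC mul0rn mulr0.
Qed.

Lemma fps_theta_t : fps_theta fps_t = fps_t.
Proof. by apply: fpsP => -[|[|n]] //; rewrite /fps_theta /fps_t /= !mulr0n mul0rn. Qed.
Lemma fps_theta_u : fps_theta fps_u = 0.
Proof. by apply: fpsP => -[|n] //; rewrite /fps_theta /fps_u /fps_const /= mulr0n mul0rn. Qed.
Lemma fps_eta_t : fps_eta fps_t = 0.
Proof.
by apply: fpsP => n; rewrite /fps_eta /fps_t -[_%:R]mulr1n -polyC_natr derivMn derivC mul0rn mulr0.
Qed.
Lemma fps_eta_u : fps_eta fps_u = fps_u.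
Proof.
apply: fpsP => -[|n]; rewrite /fps_eta /fps_u /fps_const /=.
  by rewrite derivX mulr1.
by rewrite mulr0n deriv0 mulr0.
Qed.

(** With [z = t u] and [q = u] the monomial [t^n u^m] is [z^n q^(m-n)]. So [fps_theta] is [z d/dz]
    at constant [q], and [theta_ff b] is [z^b (d/dz)^b]. *)
Fixpoint theta_ff b f : A :=
  if b is b'.+1 then fps_theta (theta_ff b' f) - theta_ff b' f *+ b' else f.

(* In the variables [z = t u], [q = u], the derivation [fps_eta - fps_theta] is
   [q d/dq], and [delta_prod c] is [q^(c+1) (d/dq)^c q^-1]. *)
Fixpoint delta_prod (c : nat) f : A :=
  if c is c'.+1 then
    fps_eta (delta_prod c' f) - fps_theta (delta_prod c' f) - delta_prod c' f *+ c'.+1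
  else f.

Lemma theta_ffE b f n : theta_ff b f n = f n *+ n ^_ b.
Proof.
elim: b => [|b IH] //=; rewrite fpsBE fps_mulrnE /fps_theta IH ffactnSr.
case: (leqP b n) => [le_bn|lt_nb]; last by rewrite !ffact_small // mul0n !mulr0n !mul0rn subrr.
by rewrite -!mulrnA -mulrnBr ?mulnBr // leq_mul2l le_bn orbT.
Qed.

Lemma delta_prodE (c : nat) f n m :
  (delta_prod c f n)`_m =
    (\prod_(i < c) (m%:R - n%:R - i.+1%:R)) * (f n)`_m.
Proof.
elim: c => [|c IH]; first by rewrite big_ord0 mul1r.
rewrite /= !fpsBE fps_mulrnE !coefB coefMn IH /fps_theta coefMn IH /fps_eta coefXM.
have -> : (if m == 0%N then 0 else (delta_prod c f n)^`()`_m.-1) = (delta_prod c f n)`_m *+ m.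
  by case: m {IH} => [|m] //; rewrite coef_deriv.
by rewrite IH big_ord_recr /=; ring.
Qed.

Lemma shift_coef a k f n m :
  ((fps_t ^+ a * (fps_u ^+ k * f)) n)`_m =
    if (a <= n)%N && (k <= m)%N then (f (n - a)%N)`_(m - k) else 0.
Proof.
rewrite fps_tXME; case: leqP => _; last by rewrite coef0.
by rewrite /fps_u -rmorphXn fpsCM coefXnM; case: leqP.
Qed.

End Filtration.

Lemma linear_dependence (F : fieldType) (I J : finType) (v : I -> J -> F) :
  (#|J| < #|I|)%N ->
  exists c : I -> F, (exists i, c i != 0) /\ forall j, \sum_i c i * v i j = 0.
Proof.
move=> ltJI; pose B := \matrix_(i < #|I|, j < #|J|) v (enum_val i) (enum_val j).
have: kermx B != 0.
  rewrite kermx_eq0 -row_leq_rank -ltnNge; apply: leq_ltn_trans ltJI.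
  exact: rank_leq_col.
case/rowV0Pn=> w /sub_kermxP wB wN0.
exists (fun i => w 0 (enum_rank i)); split.
  have [k wk] : exists k, w 0 k != 0.
    apply: contrapT => nk; case/eqP: wN0; apply/rowP => k; rewrite mxE.
    by apply/eqP; apply: contraT => wk; case: nk; exists k.
  by exists (enum_val k); rewrite enum_valK.
move=> j; have := congr1 (fun C : 'rV_ _ => C 0 (enum_rank j)) wB.
rewrite !mxE; apply: etrans; rewrite (reindex (@enum_val I I)) /=; last first.
  by apply: onW_bij; exact: enum_val_bij.
by apply: eq_bigr => i _; rewrite enum_valK mxE enum_rankK.
Qed.

(** * Clearing denominators in derivatives of an algebraic series *)

Section Diagonal.
Local Notation A := (fps {poly rat}).
Local Notation tu := [:: (fps_t : A); fps_u].
Implicit Types (f g x mu : A) (P : {poly (fps {poly rat})}).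

(** The difference is [P] with [D] applied to its coefficients, evaluated at [mu]. At a root of [P]
    this shows that [P'(mu)] is a denominator for [D mu]. *)
Lemma gen_by_horner_derivation (s : seq A) D mu P : derivation D ->
  {subset tu <= s} -> mu \in s -> (forall x, x \in tu -> gen_by tu (D x)) ->
  (forall k, gen_by tu P`_k) ->
  gen_by s (D P.[mu] - P^`().[mu] * D mu).
Proof.
move=> derD sub mus Dtu; have [DD DM Dc] := derD.
have DS f : gen_by tu f -> gen_by tu (D f).
  move=> [e]; elim=> [c|{}e {}f g _ IHf _ IHg|{}e x {}f xs Hf IH|{}e {}f _ IH] //.
  - by rewrite Dc; exact: gen_by0.
  - by rewrite DD; exact: gen_byD.
  - rewrite DM; apply: gen_byD; apply: gen_byM => //; [exact: Dtu|by exists e|exact: gen_by_mem].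
elim/poly_ind: P => [_|P c IH PS].
  by rewrite horner0 derivation0 // deriv0 horner0 mul0r subrr; exact: gen_by0.
have cS : gen_by tu c by have := PS 0%N; rewrite coefD coefMX coefC add0r.
have {}PS k : gen_by tu P`_k by have := PS k.+1; rewrite coefD coefMX coefC addr0.
have PmuS : gen_by s P.[mu].
  rewrite horner_coef; apply: (big_ind (gen_by s)); [exact: gen_by0|exact: gen_byD|].
  move=> i _; apply: gen_byM; first exact: gen_by_sub (PS i).
  by apply: gen_byX; exact: gen_by_mem.
rewrite hornerMXaddC derivD derivM derivX derivC addr0 mulr1 !hornerE DD DM.
have -> : D P.[mu] * mu + P.[mu] * D mu + D c - (P^`().[mu] * mu + P.[mu]) * D mu =
   (D P.[mu] - P^`().[mu] * D mu) * mu + D c by ring.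
apply: gen_byD; last by apply: (gen_by_sub sub); exact: DS.
by apply: gen_byM; [exact: IH|exact: gen_by_mem].
Qed.

(** As [P] is monic of degree [d + 1], powers of [mu] reduce to exponents at most [d]; each
    multiplication by a generator costs degree at most [K] in [t] and [u]. *)
Lemma filt_integral mu P d K : (0 < K)%N -> P.[mu] = 0 -> P \is monic ->
  size P = d.+2 -> (forall k, filt tu K P`_k) ->
  forall e f, filt [:: fps_t; fps_u; mu] e f ->
  exists2 p : nat -> A, (forall k, filt tu (e * K) (p k)) &
    f = \sum_(k < d.+1) p k * mu ^+ k.
Proof.
move=> K_gt0 Pmu Pmon sP PK e f.
elim=> [c|{}e {}f g _ [p Hp ->] _ [q Hq ->]|{}e x {}f xs _ [p Hp ->]|{}e {}f _ [p Hp ->]].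
- exists (fun k => if k == 0%N then fps_rat c else 0).
    by case=> [|k]; [exact: filt_rat|exact: filt0].
  by rewrite big_ord_recl mulr1 big1 ?addr0 // => i _; rewrite mul0r.
- exists (fun k => p k + q k) => [k|]; first exact: filtD.
  by rewrite -big_split; apply: eq_bigr => i _; rewrite mulrDl.
- have gen y : y \in tu -> exists2 q : nat -> A, (forall k, filt tu (e.+1 * K) (q k)) &
      y * (\sum_(k < d.+1) p k * mu ^+ k) = \sum_(k < d.+1) q k * mu ^+ k.
    move=> ys; exists (fun k => y * p k) => [k|].
      by apply: (@filt_le _ (e * K).+1); [lia|exact: filt_gen].
    by rewrite mulr_sumr; apply: eq_bigr => i _; rewrite mulrA.
  have [xtu|xtu] := boolP (x \in tu); first exact: gen.
  have -> : x = mu.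
    by move: xs xtu; rewrite !inE; case: (x == fps_t); case: (x == fps_u) => //= /eqP.
  have muS : mu ^+ d.+1 = - \sum_(k < d.+1) P`_k * mu ^+ k.
    have := Pmu; rewrite horner_coef sP big_ord_recr /=.
    move/monicP: Pmon; rewrite lead_coefE sP /= => ->.
    by rewrite mul1r => /eqP; rewrite addrC addr_eq0 => /eqP.
  exists (fun k => (if k is k'.+1 then p k' else 0) - p d * P`_k) => [k|].
    apply: filtB; last by rewrite mulSn addnC; exact: filtM.
    by case: k => [|k]; [exact: filt0|apply: filt_le (Hp k); lia].
  under [RHS]eq_bigr do rewrite mulrBl -mulrA.
  rewrite sumrB -mulr_sumr -[X in _ = _ - p d * X]opprK -muS mulrN opprK.
  rewrite [in RHS]big_ord_recl /= mul0r add0r big_ord_recr /= mulrDr mulr_sumr; congr (_ + _).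
    by apply: eq_bigr => i _; rewrite /= exprS; ring.
  by rewrite exprS; ring.
- exists p => // k; apply: filt_le (Hp k); lia.
Qed.

(** A derivation costs two factors [F], a multiplication by [t] or [u] is charged one, and [f]
    itself one. The total [2 * a + 2 * b + c + M + 1] is at most [6 * M.+1]. *)
Lemma filt_op (s : seq A) F K f (M a b c : nat) :
  {subset tu <= s} -> filt s K F ->
  (forall x, x \in s -> filt s K (F * fps_theta x)) ->
  (forall x, x \in s -> filt s K (F * fps_eta x)) ->
  filt s K (F * f) -> (a <= M)%N -> (b <= M)%N -> (c <= M)%N ->
  filt s (6 * M.+1 * K.+1) (F ^+ (6 * M.+1) *
    (fps_t ^+ a * (fps_u ^+ (a + (M - c)) * theta_ff b (delta_prod c f)))).
Proof.
move=> sub HF HT HE Hf le_aM le_bM le_cM.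
pose Q j g := filt s (j * K.+1) (F ^+ j * g).
have QS j g : Q j g -> Q j.+1 g.
  rewrite /Q exprS -mulrA => Hg; apply: (@filt_le _ (K + j * K.+1)); first by lia.
  exact: filtM.
have Qle i j g : (i <= j)%N -> Q i g -> Q j g.
  by move=> /subnK <-; elim: (j - i)%N => // k IH /IH /QS.
have QD D j g : derivation D -> (forall x, x \in s -> filt s K (F * D x)) ->
    Q j g -> Q j.+2 (D g).
  move=> derD HD Qg; rewrite /Q.
  (* The Leibniz rule for [D (F ^+ j * g)], multiplied by [F ^+ 2] and solved for the term with
     [D g]. *)
  have -> : F ^+ j.+2 * D g =
      F * (F * D (F ^+ j * g)) - ((F * D F) * (F ^+ j * g)) *+ j.
    have [_ DM _] := derD; rewrite DM !mulrDr [F * (D _ * g)]mulrA derivationX //.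
    rewrite !exprS mulrnAl mulrnAr.
    have -> : F * (F ^+ j * D F * g) = F * D F * (F ^+ j * g) by ring.
    by rewrite addrAC subrr add0r; ring.
  apply: (@filt_le _ (K + (j * K.+1 + K))); first by lia.
  apply: filtB; first by apply: filtM => //; exact: filt_derivation.
  apply: filtMn; apply: (@filt_le _ ((K + K) + j * K.+1)); first by lia.
  by apply: filtM => //; exact: filt_derivation.
have QB j g h : Q j g -> Q j h -> Q j (g - h).
  by rewrite /Q mulrBr; exact: filtB.
have QMn j g k : Q j g -> Q j (g *+ k) by rewrite /Q mulrnAr; exact: filtMn.
have QE k : Q (2 * k).+1 (delta_prod k f).
  elim: k => [|k IH].
    by rewrite /Q muln0 mul1n expr1; apply: filt_le Hf; lia.
  have -> : (2 * k.+1).+1 = (2 * k).+3 by lia.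
  apply: (QB); first by apply: (QB); apply: QD => //;
    [exact: fps_eta_derivation|exact: fps_theta_derivation].
  by apply: (QMn); do 2!apply/QS.
have QL k : Q (2 * k + (2 * c).+1)%N (theta_ff k (delta_prod c f)).
  elim: k => [|k IH]; first exact: QE.
  have -> : (2 * k.+1 + (2 * c).+1)%N = (2 * k + (2 * c).+1).+2 by lia.
  apply: (QB); first by apply: QD => //; exact: fps_theta_derivation.
  by apply: (QMn); do 2!apply/QS.
have QX x k j g : x \in tu -> Q j g -> Q (k + j)%N (x ^+ k * g).
  move=> xs Qg; elim: k => [|k IH]; first by rewrite mul1r.
  rewrite addSn /Q exprS.
  have -> : x ^+ k.+1 * g = x * (x ^+ k * g) by rewrite mulrA exprS.
  have -> : F * F ^+ (k + j) * (x * (x ^+ k * g)) =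
            F * (x * (F ^+ (k + j) * (x ^+ k * g))) by ring.
  apply: (@filt_le _ (K + ((k + j) * K.+1).+1)); first by lia.
  by apply: filtM => //; apply: filt_gen IH; exact: sub.
have Qt : (fps_t : A) \in tu by rewrite inE eqxx.
have Qu : fps_u \in tu by rewrite !inE eqxx orbT.
have := QX _ a _ _ Qt (QX _ (a + (M - c))%N _ _ Qu (QL b)).
by apply: (Qle); lia.
Qed.

End Diagonal.

(** * Lipshitz's argument for the diagonal *)

Section DiagonalDFinite.
Local Notation A := (fps {poly rat}).
Local Notation tu := [:: (fps_t : A); fps_u].
Implicit Types (f g x mu F : A) (P : {poly (fps {poly rat})}).

(** In the variables [z], [q] this is [q^(M+1) z^(a+b) (d/dz)^b (d/dq)^c] applied to [f / q]. The
    factor [q^(M+1)], common to all operators, keeps the exponents nonnegative; apart from it they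
    do not involve [q]. *)
Definition lip_op (M a b c : nat) f : A :=
  fps_t ^+ a * (fps_u ^+ (a + (M - c)) * theta_ff b (delta_prod c f)).

(* Dimension count: up to a common denominator the [(M+1)^3] functions
   [lip_op M a b c f] lie in a space of dimension [O(M^2)]. *)
Lemma lipshitz_relation mu P d K F f :
  P.[mu] = 0 -> P \is monic -> size P = d.+2 -> (forall k, filt tu K P`_k) ->
  F != 0 -> filt [:: fps_t; fps_u; mu] K F ->
  (forall x, x \in [:: fps_t; fps_u; mu] ->
    filt [:: fps_t; fps_u; mu] K (F * fps_theta x)) ->
  (forall x, x \in [:: fps_t; fps_u; mu] ->
    filt [:: fps_t; fps_u; mu] K (F * fps_eta x)) ->
  filt [:: fps_t; fps_u; mu] K (F * f) ->
  exists M (c : 'I_M.+1 -> 'I_M.+1 -> 'I_M.+1 -> rat),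
    (exists i j k, c i j k != 0) /\
    \sum_i \sum_j \sum_k fps_rat (c i j k) * lip_op M i j k f = 0.
Proof.
move=> Pmu Pmon sP PK FN0 HF HT HE Hf.
(* [n] bounds the degrees after clearing denominators and reducing modulo [P]. As
   [n.+1 <= 7 * K.+1 ^ 2 * M.+1], there are at most [49 * d.+1 * K.+1 ^ 4 * M.+1 ^ 2 = M * M.+1 ^ 2]
   coefficients, fewer than the [M.+1 ^ 3] operators. *)
pose M := (49 * d.+1 * K.+1 ^ 4)%N; pose n := (6 * M.+1 * K.+1 * K.+1)%N.
pose I : finType := ('I_M.+1 * 'I_M.+1 * 'I_M.+1)%type.
pose op (o : I) := lip_op M o.1.1 o.1.2 o.2 f.
have opP o : exists p : nat -> A, (forall k, filt tu n (p k)) /\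
    F ^+ (6 * M.+1) * op o = \sum_(k < d.+1) p k * mu ^+ k.
  have sub : {subset tu <= [:: fps_t; fps_u; mu]}.
    by move=> x; rewrite !inE orbA => ->.
  have PK' k : filt tu K.+1 (P`_k) by exact: filt_weak.
  have Ho := filt_op sub HF HT HE Hf (ltn_ord o.1.1 : (o.1.1 <= M)%N)
    (ltn_ord o.1.2 : (o.1.2 <= M)%N) (ltn_ord o.2 : (o.2 <= M)%N).
  have [p Hp Ep] := filt_integral (ltn0Sn K) Pmu Pmon sP PK' Ho.
  by exists p.
have [p {}opP] := choice opP.
pose J : finType := ('I_d.+1 * 'I_n.+1 * 'I_n.+1)%type.
pose v o (j : J) := (p o j.1.1 j.1.2)`_j.2.
have ltJ : (#|J| < #|I|)%N.
  rewrite !card_prod !card_ord.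
  have le_n : (n.+1 <= 7 * K.+1 ^ 2 * M.+1)%N by rewrite /n expnS expn1; nia.
  apply: (@leq_ltn_trans (d.+1 * (7 * K.+1 ^ 2 * M.+1) * (7 * K.+1 ^ 2 * M.+1))%N).
    by apply: leq_mul => //; apply: leq_mul.
  have -> : (d.+1 * (7 * K.+1 ^ 2 * M.+1) * (7 * K.+1 ^ 2 * M.+1) = M * (M.+1 * M.+1))%N.
    by rewrite /M (expnD _ 2 2); ring.
  by rewrite -mulnA ltn_pmul2r.
have [c [cnz cv]] := linear_dependence v ltJ.
exists M, (fun a b k => c (a, b, k)); split.
  by case: cnz => -[[a b] k] co; exists a, b, k.
apply: (@fps_mulf_eq0 _ (F ^+ (6 * M.+1))).
  apply/eqP => /eqP; elim: (6 * M.+1)%N => [|k IH]; first by rewrite oner_eq0.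
  by rewrite exprS => /eqP /(fps_mulf_eq0 FN0) /eqP.
transitivity (\sum_(o : I) fps_rat (c o) * (F ^+ (6 * M.+1) * op o)).
  rewrite !pair_bigA /= mulr_sumr; apply: eq_bigr => -[[a b] k] _ /=.
  by rewrite mulrCA.
transitivity (\sum_(k < d.+1) (\sum_(o : I) fps_rat (c o) * p o k) * mu ^+ k).
  under eq_bigr => o' _ do rewrite (opP o').2 mulr_sumr.
  rewrite exchange_big; apply: eq_bigr => k _; rewrite mulr_suml.
  by apply: eq_bigr => o' _; rewrite mulrA.
rewrite big1 // => k _; rewrite [X in X * _](_ : _ = 0) ?mul0r //.
apply: fpsP => i; apply/polyP => j; rewrite fps_sumE coef_sum fps0E coef0.
under eq_bigr do rewrite fpsCM coefCM.
have [le_in|lt_ni] := leqP i n; last first.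
  by rewrite big1 // => o' _; rewrite (filt_tu_coef ((opP o').1 k)) ?lt_ni ?mulr0.
have [le_jn|lt_nj] := leqP j n; last first.
  by rewrite big1 // => o' _; rewrite (filt_tu_coef ((opP o').1 k)) ?lt_nj ?orbT ?mulr0.
rewrite -[RHS](cv (k, Ordinal (le_in : (i < n.+1)%N), Ordinal (le_jn : (j < n.+1)%N))).
by apply: eq_bigr => o' _.
Qed.

Lemma fps_derivnE (F : fieldType) b (h : nat -> F) n :
  iter b (@fps_deriv F) h n = h (n + b)%N *+ (n + b) ^_ b.
Proof.
elim: b n => [|b IH] n; first by rewrite addn0 ffactn0.
by rewrite iterS /fps_deriv IH addSnnS -mulrnA ffactnSr -addSnnS addnK.
Qed.

(* The relation is read at [t^n u^(n+M-k)] for the least [k] such that some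
   [c a b k] is nonzero: there the factor [(k' - k - 1) ... (- k)] produced by
   [delta_prod k'] vanishes for every [k' > k]. *)
Lemma relation_diagonal f M (c : 'I_M.+1 -> 'I_M.+1 -> 'I_M.+1 -> rat) :
  (exists i j k, c i j k != 0) ->
  \sum_i \sum_j \sum_k fps_rat (c i j k) * lip_op M i j k f = 0 ->
  D_finite (fun n => (f n)`_n).
Proof.
move=> cN0 rel.
pose good k := [exists i, exists j, exists k' : 'I_M.+1, (k' == k :> nat) && (c i j k' != 0)].
have [k0 good0] : exists k, good k.
  case: cN0 => i [j [k ck]]; exists k.
  by apply/existsP; exists i; apply/existsP; exists j; apply/existsP; exists k; rewrite eqxx.
case: (ex_minnP (ex_intro good k0 good0)) => kk good_kk kk_min {k0 good0}.
have [i0 [j0 [k [kE ck]]]] : exists i j (k : 'I_M.+1), k = kk :> nat /\ c i j k != 0.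
  move: good_kk => /existsP[i /existsP[j /existsP[k /andP[/eqP kE ck]]]].
  by exists i, j, k.
have c_lt i j (k' : 'I_M.+1) : (k' < k)%N -> c i j k' = 0.
  move=> lt_k; apply/eqP; apply: contraLR lt_k => ck'; rewrite -leqNgt kE.
  by apply: kk_min; apply/existsP; exists i; apply/existsP; exists j; apply/existsP;
    exists k'; rewrite eqxx.
have {kE kk good_kk kk_min} le_kM : (k <= M)%N by rewrite -ltnS.
pose h n := (f n)`_n.
(* The factor [(-1)^k k!] by which [delta_prod k] acts on [t^n u^n]. *)
pose C : rat := \prod_(i < k) (- (i.+1)%:R).
have CN0 : C != 0.
  by apply/prodf_neq0 => i _; rewrite oppr_eq0 pnatr_eq0.
have coef_op n (i j k' : 'I_M.+1) : c i j k' != 0 ->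
    (lip_op M i j k' f n)`_(n + M - k) =
      if (i <= n)%N && (k' == k) then C * (h (n - i)%N *+ (n - i) ^_ j) else 0.
  move=> cN; have le_kk' : (k <= k')%N by rewrite leqNgt; apply: contraNN cN => /c_lt ->.
  have lt_iM := ltn_ord i; have lt_k'M := ltn_ord k'.
  rewrite /lip_op shift_coef; have [le_in|//] := leqP i n.
  have -> : (i + (M - k') <= n + M - k)%N by lia.
  have -> : (n + M - k - (i + (M - k')) = n - i + (k' - k))%N by lia.
  rewrite /= theta_ffE coefMn delta_prodE; have [->|neq_k] := eqVneq k' k.
    rewrite subnn addn0 mulrnAr; congr (_ * _ *+ _).
    by apply: eq_bigr => l _; rewrite subrr sub0r.
  have lt_kk' : (k < k')%N by rewrite ltn_neqAle le_kk' andbT eq_sym.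
  have lt_l : (k' - k.+1 < k')%N by lia.
  rewrite (bigD1 (Ordinal lt_l)) //= natrD [_%:R + _]addrC addrK.
  by rewrite (_ : (k' - k.+1).+1 = k' - k)%N ?subrr ?mul0r ?mul0rn //; lia.
have relh n : \sum_(i < M.+1) \sum_(j < M.+1)
    (if (i <= n)%N then c i j k * (h (n - i)%N *+ (n - i) ^_ j) else 0) = 0.
  have := congr1 (fun g : A => (g n)`_(n + M - k)) rel.
  rewrite fps0E coef0 fps_sumE coef_sum => relE.
  apply: (mulfI CN0); rewrite mulr0 -[RHS]relE mulr_sumr; apply: eq_bigr => i _.
  rewrite fps_sumE coef_sum mulr_sumr; apply: eq_bigr => j _.
  rewrite fps_sumE coef_sum (bigD1 k) //= big1 ?addr0 => [|k' neq_k].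
    rewrite fpsCM coefCM; have [->|cN] := eqVneq (c i j k) 0.
      by rewrite !mul0r if_same mulr0.
    by rewrite coef_op // eqxx andbT; case: leqP => _; rewrite ?mulr0 // mulrCA.
  rewrite fpsCM coefCM; have [->|cN] := eqVneq (c i j k') 0; first by rewrite mul0r.
  by rewrite coef_op // (negPf neq_k) andbF mulr0.
(* Since [theta_ff j] is [z^j (d/dz)^j], the term [c i j k] contributes [z^(i+j)] to the coefficient
   of the [j]-th derivative. *)
pose p (j : 'I_M.+1) : {poly rat} := \sum_(i < M.+1) c i j k *: 'X^(i + j).
have coef_p (j : 'I_M.+1) l : (p j)`_l = \sum_(i < M.+1) c i j k * (l == i + j)%N%:R.
  by rewrite coef_sum; apply: eq_bigr => i _; rewrite coefZ coefXn.
exists M, p; split.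
  exists j0; apply: contraNneq ck => p0.
  have := coef_p j0 (i0 + j0)%N; rewrite p0 coef0 (bigD1 i0) //= eqxx mulr1 big1 ?addr0.
    by move=> <-.
  move=> i neq_i; rewrite eqn_add2r (_ : (i0 == i :> nat) = false) ?mulr0 //.
  by apply/negbTE; move: neq_i; rewrite -val_eqE /= eq_sym.
move=> n; rewrite -[RHS](relh n) [RHS]exchange_big; apply: eq_bigr => j _.
transitivity (\sum_(l < n.+1) \sum_(i < M.+1)
    c i j k * (l == i + j :> nat)%N%:R * (h (n - l + j)%N *+ (n - l + j) ^_ j)).
  by apply: eq_bigr => l _; rewrite -mulr_suml -coef_p; congr (_ * _); exact: fps_derivnE.
rewrite exchange_big; apply: eq_bigr => i _ /=.
have [le_ijn|lt_n] := leqP (i + j)%N n.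
  have lt_ij : (i + j < n.+1)%N by [].
  rewrite (bigD1 (Ordinal lt_ij)) //= eqxx mulr1 big1 ?addr0 => [|l neq_l].
    have -> : (n - (i + j) + j = n - i)%N by lia.
    by have -> : (i <= n)%N by lia.
  rewrite (_ : (l == i + j :> nat)%N = false) ?mulr0 ?mul0r //.
  exact: negbTE.
rewrite big1 => [|l _]; last first.
  by rewrite (_ : (l == i + j :> nat)%N = false) ?mulr0 ?mul0r //; have := ltn_ord l; lia.
(* For [i <= n < i + j] the convolution has no such term, and on the other side the falling
   factorial is 0. *)
by case: leqP => // le_in; rewrite ffact_small ?mulr0n ?mulr0 //; lia.
Qed.

(** The series [den * P'(mu)] clears the denominators of [f] and of both Euler derivatives of [mu];
    it is nonzero since there are no zero divisors. *)
Theorem algebraic_diagonal_D_finite mu P d f num den :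
  P.[mu] = 0 -> P \is monic -> size P = d.+2 ->
  (exists K, forall k, filt tu K P`_k) -> P^`().[mu] != 0 ->
  gen_by [:: fps_t; fps_u; mu] num -> gen_by [:: fps_t; fps_u; mu] den ->
  den != 0 -> den * f = num -> D_finite (fun n => (f n)`_n).
Proof.
move=> Pmu Pmon sP [K0 PK] dPN0 Hnum Hden denN0 Ef.
set s := [:: fps_t; fps_u; mu].
have sub : {subset tu <= s} by move=> x; rewrite !inE orbA => ->.
have mus : mu \in s by rewrite !inE eqxx !orbT.
have ts : gen_by tu fps_t by apply: gen_by_mem; rewrite inE eqxx.
have us : gen_by tu fps_u by apply: gen_by_mem; rewrite !inE eqxx orbT.
have PS k : gen_by tu P`_k by exists K0.
pose F := den * P^`().[mu].
have dPS : gen_by s P^`().[mu].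
  rewrite horner_coef; apply: (big_ind (gen_by s)); [exact: gen_by0|exact: gen_byD|].
  move=> i _; rewrite coef_deriv; apply: gen_byM; last by apply: gen_byX; exact: gen_by_mem.
  by apply: gen_byMn; apply: gen_by_sub (PS _).
have FN0 : F != 0.
  by apply: contraNneq dPN0 => /(fps_mulf_eq0 denN0) ->.
have FD D : derivation D -> (forall x, x \in tu -> gen_by tu (D x)) ->
    forall x, x \in s -> gen_by s (F * D x).
  move=> derD Dtu x xs; have [xtu|xtu] := boolP (x \in tu).
    by do 2?apply: gen_byM => //; exact: gen_by_sub (Dtu _ xtu).
  have -> : x = mu.
    by move: xs xtu; rewrite !inE; case: (x == fps_t); case: (x == fps_u) => //= /eqP.
  rewrite -mulrA; apply: gen_byM => //.
  have := gen_by_horner_derivation derD sub mus Dtu PS.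
  by rewrite Pmu derivation0 // sub0r => /gen_byN; rewrite opprK.
have FT : forall x, x \in s -> gen_by s (F * fps_theta x).
  apply: FD; first exact: fps_theta_derivation.
  move=> x; rewrite !inE => /orP[] /eqP->; first by rewrite fps_theta_t.
  by rewrite fps_theta_u; exact: gen_by0.
have FE : forall x, x \in s -> gen_by s (F * fps_eta x).
  apply: FD; first exact: fps_eta_derivation.
  move=> x; rewrite !inE => /orP[] /eqP->; last by rewrite fps_eta_u.
  by rewrite fps_eta_t; exact: gen_by0.
have FS : gen_by s F by exact: gen_byM.
have FfS : gen_by s (F * f).
  by rewrite /F mulrAC Ef; exact: gen_byM.
have bound (G : A -> A) : (forall x, x \in s -> gen_by s (G x)) ->
    exists K, forall x, x \in s -> filt s K (G x).
  rewrite /s => HG; have [|K1 H1] := HG fps_t; first by rewrite inE eqxx.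
  have [|K2 H2] := HG fps_u; first by rewrite !inE eqxx orbT.
  have [|K3 H3] := HG mu; first by [].
  exists (K1 + K2 + K3)%N => x; rewrite !inE => /or3P[] /eqP->;
   [apply: filt_le H1|apply: filt_le H2|apply: filt_le H3]; lia.
have [KT HT] := bound _ FT; have [KE HE] := bound _ FE.
have [KF HF] := FS; have [Kf Hf] := FfS.
pose K := (K0 + KT + KE + KF + Kf)%N.
have [||||||M [c [cN0 rel]]] := @lipshitz_relation mu P d K F f Pmu Pmon sP.
- by move=> k; apply: filt_le (PK k); lia.
- exact: FN0.
- by apply: filt_le HF; lia.
- by move=> x xs; apply: filt_le (HT x xs); lia.
- by move=> x xs; apply: filt_le (HE x xs); lia.
- by apply: filt_le Hf; lia.
exact: relation_diagonal cN0 rel.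
Qed.

End DiagonalDFinite.

(** * The word problem *)

Lemma nseqSr (T : Type) n (x : T) : nseq n.+1 x = rcons (nseq n x) x.
Proof. by elim: n => //= n ->. Qed.

Section BaumslagSolitar.
Variable N : nat.
Hypothesis N_gt0 : (0 < N)%N.
Local Notation word := (seq (letter bs_gen)).
Local Notation La := ((bs_a, false) : letter bs_gen).
Local Notation peq := (presented_eq (bs_rel N)).
Implicit Types (w u v : word) (x y : letter bs_gen) (e : bool) (r : nat)
  (s : seq (bool * nat)).

(* [(r, [:: (e1, r1); (e2, r2); ...])] encodes the normal form
   [... b^e2 a^r1 b^e1 a^r] of the quotient [Z/N * Z] by [a^N]; words act on
   the right. *)
Definition bs_state : Type := (nat * seq (bool * nat))%type.
Implicit Type q : bs_state.

Definition bs_one : bs_state := (0%N, [::]).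

Definition bs_step q x : bs_state :=
  let: (r, s) := q in
  match x with
  | (bs_a, false) => (if r.+1 == N then 0%N else r.+1, s)
  | (bs_a, true) => (if r == 0%N then N.-1 else r.-1, s)
  | (bs_b, e) =>
      if r is 0%N then
        if s is (e', r') :: s' then
          if e' == ~~ e then (r', s') else (0%N, (e, r) :: s)
        else (0%N, (e, r) :: s)
      else (0%N, (e, r) :: s)
  end.

Fixpoint bs_valid_from r s : bool :=
  (r < N)%N &&
  if s is (e, r') :: s' then
    (if s' is (e', _) :: _ then ~~ ((r' == 0%N) && (e' == ~~ e)) else true)
      && bs_valid_from r' s'
  else true.

Definition bs_valid q := bs_valid_from q.1 q.2.

Lemma bs_valid_lt r s : bs_valid_from r s -> (r < N)%N.
Proof. by case: s => [|[e r'] s] /= /andP[]. Qed.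

Lemma bs_valid_r r r' s : (r' < N)%N -> bs_valid_from r s -> bs_valid_from r' s.
Proof. by move=> lt_r'; case: s => [|[e r''] s] /= /andP[_ H]; apply/andP. Qed.

Lemma bs_one_valid : bs_valid bs_one.
Proof. by rewrite /bs_valid /= N_gt0. Qed.

Lemma bs_step_valid q x : bs_valid q -> bs_valid (bs_step q x).
Proof.
case: q x => r s [[] e]; rewrite /bs_valid /= => Hq.
  have lt_rN := bs_valid_lt Hq.
  case: e => /=; apply: bs_valid_r Hq.
    by case: eqP => _; lia.
  by case: eqP => // neq_r; lia.
case: r Hq => [|r] Hq /=; last first.
  by rewrite N_gt0 Hq andbT; case: (s) => [|[e' r'] s'].
case: s Hq => [|[e' r'] s'] Hq /=; first by rewrite N_gt0.
case: ifPn => [_|neq]; first by move: Hq => /= /and3P[].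
by rewrite /= (negPf neq) N_gt0; move: Hq => /= /andP[].
Qed.

(** When [b^e] cancels the last [b]-letter, its inverse must push that letter back instead of
    cancelling again; validity of the state ensures this. *)
Lemma bs_stepK q x : bs_valid q -> bs_step (bs_step q x) (inv_letter x) = q.
Proof.
case: q x => r s [[] e]; rewrite /bs_valid /= => Hq.
  have lt_rN := bs_valid_lt Hq.
  case: e => /=.
    by case: r {Hq} lt_rN => [|r] lt_rN /=; case: eqP => //; lia.
  by case: (r.+1 =P N) => //= <-.
case: r Hq => [|r] Hq /=; last by rewrite negbK eqxx.
case: s Hq => [|[e' r'] s'] Hq /=; first by rewrite negbK eqxx.
case: ifPn => [/eqP e'E|neq] /=; last by rewrite negbK eqxx.
move: Hq => /= /and3P[_ + _].
case: r' => [|r'] /=; last by rewrite e'E.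
by case: s' => [|[e'' r''] s''] /=; rewrite e'E // => /negPf ->.
Qed.

Lemma bs_act_valid q w : bs_valid q -> bs_valid (foldl bs_step q w).
Proof. by elim: w q => // x w IH q Hq; exact/IH/bs_step_valid. Qed.

Lemma bs_act_nseq_a r s k : (r < N)%N ->
  foldl bs_step (r, s) (nseq k La) = ((r + k) %% N, s)%N.
Proof.
elim: k r => [|k IH] r lt_rN; first by rewrite addn0 modn_small.
rewrite /=; case: eqP => [eN|neN]; rewrite IH ?addnS ?addSn //; last by lia.
by rewrite add0n -addSn eN modnDl.
Qed.

(** * Soundness of the action and of the exponent sum *)

Definition letter_aexp x : int :=
  if x.1 is bs_a then (if x.2 then -1 else 1) else 0.
Definition aexp w : int := \sum_(x <- w) letter_aexp x.

Lemma aexp_cat u v : aexp (u ++ v) = aexp u + aexp v.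
Proof. exact: big_cat. Qed.

Lemma aexp_nseq_a k : aexp (nseq k La) = k.
Proof. by rewrite /aexp big_nseq -[RHS]mulr1n; elim: k => //= k ->. Qed.

(** On valid states [a^N] acts trivially, and both sides of the defining relation contain [a]
    exactly [N] times. *)
Lemma peq_sound u v : peq u v ->
  (forall q, bs_valid q -> foldl bs_step q u = foldl bs_step q v) /\ aexp u = aexp v.
Proof.
elim=> {u v} [u v []|x|u|u v _ [IH1 IH2]|u v w _ [IH1 IH2] _ [IH3 IH4]
             |u u' v v' _ [IH1 IH2] _ [IH3 IH4]] //.
- split=> [q Hq|]; last first.
    by rewrite -cats1 -[_ :: nseq _ _]cat1s !aexp_cat addrC.
  rewrite -cats1 foldl_cat /=.
  have act_a (p : bs_state) : bs_valid p -> foldl bs_step p (nseq N La) = p.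
    case: p => r s /bs_valid_lt lt_rN.
    by rewrite bs_act_nseq_a // modnDr modn_small.
  by rewrite !act_a //; exact: bs_step_valid.
- split=> [q Hq|]; first exact: bs_stepK.
  by rewrite /aexp big_cons big_seq1 big_nil; case: x => -[] [].
- by split=> // q Hq; rewrite IH1.
- by split=> [q Hq|]; [rewrite IH1 ?IH3|rewrite IH2].
- split=> [q Hq|]; last by rewrite !aexp_cat IH2 IH4.
  by rewrite !foldl_cat IH1 // IH3 //; exact: bs_act_valid.
Qed.

Local Notation "u == v" := (peq u v).
Local Notation aN := (nseq N La).

(** * Completeness of the two invariants *)

Lemma peqrefl u : u == u. Proof. exact: presented_refl. Qed.
Lemma peqsym u v : u == v -> v == u. Proof. exact: presented_sym. Qed.
Lemma peqtrans v u w : u == v -> v == w -> u == w. Proof. exact: presented_trans. Qed.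
Lemma peqcat u u' v v' : u == u' -> v == v' -> u ++ v == u' ++ v'.
Proof. exact: presented_cat. Qed.
Lemma peq_catl w u v : u == v -> w ++ u == w ++ v.
Proof. by move=> ?; apply: peqcat => //; exact: peqrefl. Qed.
Lemma peq_catr w u v : u == v -> u ++ w == v ++ w.
Proof. by move=> ?; apply: peqcat => //; exact: peqrefl. Qed.

Lemma peq_invr x u v : u ++ [:: x, inv_letter x & v] == u ++ v.
Proof. by apply: peq_catl; rewrite -[RHS in _ == RHS]cat0s; apply: (@peq_catr v [:: x; _]); exact: presented_inv. Qed.

Lemma inv_letterK x : inv_letter (inv_letter x) = x.
Proof. by case: x => s e; rewrite /inv_letter /= negbK. Qed.

Lemma peq_invl x u v : u ++ [:: inv_letter x, x & v] == u ++ v.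
Proof. by have := peq_invr (inv_letter x) u v; rewrite inv_letterK. Qed.

Lemma peq_central_inv x : aN ++ [:: x] == [:: x] ++ aN ->
  aN ++ [:: inv_letter x] == [:: inv_letter x] ++ aN.
Proof.
move=> cx; apply: (@peqtrans ([:: inv_letter x; x] ++ aN ++ [:: inv_letter x])).
  by apply: peqsym; exact: (peq_invl x [::]).
have := peq_catr [:: inv_letter x] (peqsym (peq_catl [:: inv_letter x] cx)).
rewrite /= -!catA => H; apply: peqtrans H _.
have := peq_invr x ([:: inv_letter x] ++ aN) [::]; rewrite cats0 /= -?catA.
exact.
Qed.

Lemma peq_aN_letter x : aN ++ [:: x] == [:: x] ++ aN.
Proof.
have ca : aN ++ [:: La] == [:: La] ++ aN.
  by rewrite cats1 -nseqSr; exact: peqrefl.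
have cb : aN ++ [:: (bs_b, false)] == [:: (bs_b, false)] ++ aN.
  by rewrite cats1; apply: presented_rel.
case: x => -[] [] //; [exact: (peq_central_inv ca)|exact: (peq_central_inv cb)].
Qed.

Lemma peq_aNk_central k w : nseq (k * N) La ++ w == w ++ nseq (k * N) La.
Proof.
have one v : aN ++ v == v ++ aN.
  elim: v => [|x v IH]; first by rewrite cats0; exact: peqrefl.
  have := peq_catr v (peq_aN_letter x); rewrite -!catA => H.
  by apply: peqtrans H _; apply: (peq_catl [:: x]).
elim: k => [|k IH]; first by rewrite cats0; exact: peqrefl.
rewrite mulSn nseqD -catA; apply: peqtrans (peq_catl _ IH) _.
by rewrite !catA; apply: peq_catr; exact: one.
Qed.

Fixpoint bs_word_from r s : word :=
  (if s is (e, r') :: s' then rcons (bs_word_from r' s') (bs_b, e) else [::]) ++ nseq r La.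
Definition bs_word q := bs_word_from q.1 q.2.

Lemma bs_word_fromE r s : bs_word_from r s = bs_word_from 0 s ++ nseq r La.
Proof. by case: s => [|[e r'] s] //=; rewrite cats0. Qed.

(** When the residue wraps around, the two words differ by a central [a^N]; the exponents [i] and
    [j] put it on the side where its power is positive. *)
Lemma peq_step q x : bs_valid q -> exists i j : nat,
  bs_word q ++ x :: nseq (i * N) La == bs_word (bs_step q x) ++ nseq (j * N) La.
Proof.
case: q x => r s [[] e]; rewrite /bs_valid /bs_word /= => Hq.
  have lt_rN := bs_valid_lt Hq; case: e => /=; last first.
    exists 0%N; rewrite mul0n; case: eqP => eN.
      exists 1%N; rewrite mul1n bs_word_fromE -catA cats1 -nseqSr eN.
      exact: peqrefl.
    exists 0%N; rewrite cats0 [X in _ == X]bs_word_fromE bs_word_fromE -catA.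
    by rewrite cats1 -nseqSr; exact: peqrefl.
  case: eqP => [->|/eqP]; last first.
    rewrite -lt0n => r_gt0; exists 0%N, 0%N; rewrite cats0 bs_word_fromE.
    rewrite [X in _ == X]bs_word_fromE -catA; apply: peq_catl.
    rewrite -{1}(prednK r_gt0) nseqSr -cats1 -catA.
    by have := peq_invr La (nseq r.-1 La) [::]; rewrite cats0.
  exists 1%N, 0%N; rewrite mul1n mul0n cats0 [X in _ == X]bs_word_fromE.
  apply: peq_catl; rewrite -[in nseq N _](prednK N_gt0).
  exact: (peq_invl La [::]).
exists 0%N, 0%N; rewrite cats0 cats1.
have push : rcons (bs_word_from r s) (bs_b, e) ==
    bs_word_from 0 ((e, r) :: s) by rewrite /= cats0; exact: peqrefl.
rewrite /=; case: r Hq push => // _; case: s => // -[e' r'] s'.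
case: eqP => [-> _|//]; rewrite /= cats0 -!cats1 -catA.
by have := peq_invl (bs_b, e) (bs_word_from r' s') [::]; rewrite cats0.
Qed.

Lemma peq_act q w : bs_valid q -> exists i j : nat,
  bs_word q ++ w ++ nseq (i * N) La == bs_word (foldl bs_step q w) ++ nseq (j * N) La.
Proof.
elim: w q => [|x w IH] q Hq.
  by exists 0%N, 0%N; exact: peqrefl.
have [i [j Hx]] := peq_step x Hq.
have [i' [j' Hw]] := IH _ (bs_step_valid x Hq).
exists (i + i')%N, (j' + j)%N => /=.
rewrite !mulnDl !nseqD.
apply: (@peqtrans (bs_word q ++ [:: x] ++ nseq (i * N) La ++ w ++ nseq (i' * N) La)).
  apply: peq_catl; rewrite -cat1s; apply: peq_catl; rewrite !catA; apply: peq_catr.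
  by apply: peqsym; exact: peq_aNk_central.
apply: (@peqtrans ((bs_word (bs_step q x) ++ nseq (j * N) La) ++ w ++ nseq (i' * N) La)).
  by rewrite -cat1s in Hx; rewrite !catA in Hx *; do 2!apply: peq_catr.
rewrite -catA; apply: peqtrans (peq_catl _ (peq_aNk_central j _)) _.
by rewrite [X in _ == X]catA [X in X == _]catA; apply: peq_catr.
Qed.

Lemma peq_cancel_nseq u k : u ++ nseq k La == nseq k La -> u == [::].
Proof.
elim: k u => [|k IH] u; first by rewrite cats0.
rewrite nseqSr -cats1 catA => H; apply: IH.
have := peq_catr [:: inv_letter La] H; rewrite -!catA => {}H.
have E v : v ++ [:: La] ++ [:: inv_letter La] == v.
  by have := peq_invr La v [::]; rewrite cats0.
by apply: peqtrans (E _); apply: peqtrans H; rewrite catA; apply: peqsym.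
Qed.

Lemma represents_identityP w :
  represents_identity (bs_rel N) w <->
    foldl bs_step bs_one w = bs_one /\ aexp w = 0.
Proof.
split=> [/peq_sound[act_w ->]|[act_w ew]].
  by rewrite act_w ?bs_one_valid //; split=> //; rewrite /aexp big_nil.
have [i [j]] := peq_act w bs_one_valid; rewrite act_w /= => H.
(* What is left is [w a^(iN) = a^(jN)]; comparing exponent sums gives [i = j], and then [a^(jN)]
   cancels. *)
have eij : i = j.
  have [_] := peq_sound H; rewrite aexp_cat ew add0r !aexp_nseq_a => -[] /eqP.
  by rewrite eqn_pmul2r // => /eqP.
by move: H; rewrite eij; exact: peq_cancel_nseq.
Qed.

End BaumslagSolitar.

(** * Green functions *)

Section GreenFunction.
Local Notation A := (fps {poly rat}).
Local Notation tu := [:: (fps_t : A); fps_u].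
Local Notation t := (fps_t : A).
Local Notation u := fps_u.
Local Notation z := (fps_t * fps_u : A).
Implicit Types (P Q : {poly (fps {poly rat})}).

Definition filt_poly P := exists K, forall k, filt tu K P`_k.

Lemma filt_polyC f : gen_by tu f -> filt_poly f%:P.
Proof. by move=> [K Hf]; exists K => k; rewrite coefC; case: eqP => _ //; exact: filt0. Qed.
Lemma filt_polyX : filt_poly 'X.
Proof. by exists 0%N => k; rewrite coefX; case: eqP => _; [exact: filt1|exact: filt0]. Qed.
Lemma filt_polyD P Q : filt_poly P -> filt_poly Q -> filt_poly (P + Q).
Proof.
move=> [K HP] [L HQ]; exists (K + L)%N => k; rewrite coefD.
by apply: filtD; [apply: filt_le (HP k)|apply: filt_le (HQ k)]; lia.
Qed.
Lemma filt_polyN P : filt_poly P -> filt_poly (- P).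
Proof. by move=> [K HP]; exists K => k; rewrite coefN; exact: filtN. Qed.
Lemma filt_polyB P Q : filt_poly P -> filt_poly Q -> filt_poly (P - Q).
Proof. by move=> HP HQ; exact/filt_polyD/filt_polyN. Qed.
Lemma filt_polyM P Q : filt_poly P -> filt_poly Q -> filt_poly (P * Q).
Proof.
move=> [K HP] [L HQ]; exists (K + L)%N => k; rewrite coefM.
apply: (big_ind (filt tu (K + L))); [exact: filt0|exact: filtD|].
by move=> i _; exact: filtM.
Qed.

(** * Chebyshev polynomials and the equation for first passages *)

Variable w : rat.
Local Notation om := (1 + fps_rat w * (fps_t * fps_u) ^+ 2 : A).

(* Chebyshev polynomials of the second kind, homogenized. *)
Fixpoint cheb k : {poly (fps {poly rat})} :=
  if k is k'.+1 then
    if k' is k''.+1 then (om%:P - 'X *+ 2) * cheb k' - (z ^+ 2)%:P * cheb k'' else 1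
  else 0.

Lemma chebSS k : cheb k.+2 = (om%:P - 'X *+ 2) * cheb k.+1 - (z ^+ 2)%:P * cheb k.
Proof. by []. Qed.

Lemma horner_chebSS k mu :
  (cheb k.+2).[mu] = (om - mu *+ 2) * (cheb k.+1).[mu] - z ^+ 2 * (cheb k).[mu].
Proof. by rewrite chebSS !hornerE. Qed.

Lemma z_gen : gen_by tu z.
Proof. by apply: gen_byM; apply: gen_by_mem; rewrite !inE eqxx ?orbT. Qed.

Lemma om_gen : gen_by tu om.
Proof.
apply: gen_byD; first exact: gen_by1.
by apply: gen_byM; [exact: gen_by_rat|apply: gen_byX; exact: z_gen].
Qed.

Lemma om0 : om 0%N = 1.
Proof. by rewrite fpsDE fpsM0 expr2 !fpsM0 !(mul0r, mulr0) addr0. Qed.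

Lemma filt_poly_cheb k : filt_poly (cheb k).
Proof.
have zC : filt_poly (z ^+ 2)%:P by apply: filt_polyC; apply: gen_byX; exact: z_gen.
have omC : filt_poly om%:P by apply: filt_polyC; exact: om_gen.
suff [] : filt_poly (cheb k) /\ filt_poly (cheb k.+1) by [].
elim: k => [|k [IH1 IH2]].
  by split; [have := filt_polyC (gen_by0 tu)|have := filt_polyC (gen_by1 tu)];
    rewrite ?polyC0.
split=> //; rewrite chebSS mulr2n.
by apply: filt_polyB; apply: filt_polyM => //; apply: filt_polyB => //; apply: filt_polyD; exact: filt_polyX.
Qed.

Lemma coef_chebSS k j : (cheb k.+2)`_j =
  om * (cheb k.+1)`_j - (if j is j'.+1 then (cheb k.+1)`_j' else 0) *+ 2
  - z ^+ 2 * (cheb k)`_j.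
Proof.
by rewrite chebSS mulrBl !coefB !coefCM mulrnAl coefMn coefXM; case: j.
Qed.

Lemma coef_cheb_big k j : (k <= j)%N -> (cheb k)`_j = 0.
Proof.
suff [] : (forall j, (k <= j)%N -> (cheb k)`_j = 0) /\
          (forall j, (k.+1 <= j)%N -> (cheb k.+1)`_j = 0) by move=> H _; exact: H.
elim: k {j} => [|k [IH1 IH2]].
  by split=> [j _|j]; [exact: coef0|rewrite coef1; case: j].
split=> // -[|j] // lt_kj; rewrite coef_chebSS IH2 ?IH1 ?IH2 //; try lia.
by rewrite !mulr0 mul0rn !subrr.
Qed.

Lemma coef_cheb_lead k : (cheb k.+1)`_k = fps_rat ((-2) ^+ k).
Proof.
elim: k => [|k IH]; first by rewrite coef1 /fps_rat expr0.
rewrite coef_chebSS IH !coef_cheb_big // !mulr0 subr0 sub0r exprS mulNr.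
by rewrite /fps_rat polyCN rmorphN /= mulr_natl polyCMn rmorphMn.
Qed.

Lemma cheb0_0 k : (cheb k.+1)`_0 0%N = 1.
Proof.
elim: k => [|k IH]; first by rewrite coef1.
rewrite coef_chebSS mul0rn subr0 fpsBE !fpsM0 IH om0 expr2 !fpsM0.
by rewrite !(mul0r, mulr0, subr0, mulr1).
Qed.

Variable n : nat.
Local Notation N := n.+1.
Local Notation bt := (t ^+ N * (1 + u ^+ (2 * N))).

(** The equation [m * (om - mu - (2 z^2 v(n) + bt) / v(N)) = 1] multiplied by [z^2 v(N)], where
    [mu = z^2 m] and [v(k)] is the value of [cheb k] at [mu]. The parameter [w] will be 0 for all
    words and 3 for reduced words. *)
Definition bs_eqn : {poly A} :=
  cheb N * (om%:P * 'X - 'X ^+ 2 - (z ^+ 2)%:P)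
   - 'X * ((z ^+ 2 *+ 2)%:P * cheb n + bt%:P).

(** The leading coefficient of [bs_eqn] is the rational [- (-2) ^ n], so a rescaling makes the
    equation monic. *)
Definition bs_poly : {poly A} := (- fps_rat ((-2) ^- n))%:P * bs_eqn.

Lemma coef_bs_eqn j : bs_eqn`_j =
  (if j is j'.+1 then om * (cheb N)`_j' else 0)
  - (if j is j'.+2 then (cheb N)`_j' else 0) - z ^+ 2 * (cheb N)`_j
  - (if j is j'.+1 then (z ^+ 2 *+ 2) * (cheb n)`_j' + bt%:P`_j' else 0).
Proof.
have -> : bs_eqn = om%:P * cheb N * 'X - cheb N * 'X^2 - (z ^+ 2)%:P * cheb N
    - ((z ^+ 2 *+ 2)%:P * cheb n + bt%:P) * 'X.
  by rewrite /bs_eqn; move: om%:P (cheb N) (z ^+ 2)%:P (_%:P * cheb n + _) => a b c d; ring.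
rewrite !coefB !coefMX coefMXn !coefCM coefD coefCM.
by case: j => [|[|j]] //=; rewrite subn2.
Qed.

Lemma horner_bs_eqn mu : bs_eqn.[mu] =
  (cheb N).[mu] * (om * mu - mu ^+ 2 - z ^+ 2)
   - mu * (z ^+ 2 *+ 2 * (cheb n).[mu] + bt).
Proof.
rewrite /bs_eqn; move: om bt (z ^+ 2 *+ 2) (z ^+ 2) => o b y2 y.
by rewrite !hornerE.
Qed.

Lemma lead_coef_bs_eqn : bs_eqn`_N.+1 = - fps_rat ((-2) ^+ n).
Proof.
rewrite coef_bs_eqn coef_cheb_lead !coef_cheb_big //; try lia.
by rewrite coefC /= !mulr0 !addr0 subr0 !sub0r subr0.
Qed.


Lemma bs_eqn_big j : (N.+1 < j)%N -> bs_eqn`_j = 0.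
Proof.
case: j => [|[|j]] //; rewrite !ltnS => lt_nj.
rewrite coef_bs_eqn !coef_cheb_big //; try lia.
by rewrite coefC !mulr0 addr0 !subr0.
Qed.

Lemma coef_bs_polyE j : bs_poly`_j = - fps_rat ((-2) ^- n) * bs_eqn`_j.
Proof. by rewrite coefCM. Qed.

Lemma bs_poly_lead : bs_poly`_N.+1 = 1.
Proof.
rewrite coef_bs_polyE lead_coef_bs_eqn mulrNN /fps_rat -rmorphM -polyCM mulVf //.
by rewrite expf_neq0 // oppr_eq0.
Qed.

Lemma size_bs_poly : size bs_poly = N.+2.
Proof.
apply/eqP; rewrite eqn_leq; apply/andP; split.
  by apply/leq_sizeP => j lt_j; rewrite coef_bs_polyE bs_eqn_big ?mulr0.
by rewrite ltnNge; apply/negP => /leq_sizeP/(_ _ (leqnn _))/eqP; rewrite bs_poly_lead oner_eq0.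
Qed.

Lemma bs_poly_monic : bs_poly \is monic.
Proof. by rewrite monicE lead_coefE size_bs_poly bs_poly_lead. Qed.

Lemma bt_gen : gen_by tu bt.
Proof.
apply: gen_byM; first by apply: gen_byX; apply: gen_by_mem; rewrite inE eqxx.
apply: gen_byD; first exact: gen_by1.
by apply: gen_byX; apply: gen_by_mem; rewrite !inE eqxx orbT.
Qed.

Lemma filt_bs_poly : filt_poly bs_poly.
Proof.
have z2 : gen_by tu (z ^+ 2) by apply: gen_byX; exact: z_gen.
apply: filt_polyM; first by apply: filt_polyC; apply: gen_byN; exact: gen_by_rat.
apply: filt_polyB; apply: filt_polyM; try exact: filt_poly_cheb; try exact: filt_polyX.
  apply: filt_polyB; last exact: filt_polyC.
  apply: filt_polyB; last by rewrite expr2; apply: filt_polyM; exact: filt_polyX.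
  by apply: filt_polyM; [apply: filt_polyC; exact: om_gen|exact: filt_polyX].
apply: filt_polyD; last by apply: filt_polyC; exact: bt_gen.
by apply: filt_polyM; [apply: filt_polyC; exact: gen_byMn|exact: filt_poly_cheb].
Qed.

Lemma z2M0 (f : A) : (z ^+ 2 * f) 0%N = 0.
Proof. by rewrite expr2 !fpsM0 !mul0r. Qed.

Lemma bt0 : bt 0%N = 0.
Proof. by rewrite exprS !fpsM0 !mul0r. Qed.

(* [z ^+ 2 * m] is the root of [bs_poly]; the generating function of the
   first passages from [b] to [1] is [z * m]. *)
Lemma bs_root : exists m vi hi : A, let mu := z ^+ 2 * m in
  [/\ bs_poly.[mu] = 0, bs_poly^`().[mu] != 0, (cheb N).[mu] * vi = 1,
      (1 - z ^+ 2 * m ^+ 2) * hi = 1 &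
      m * (om - mu - (z ^+ 2 *+ 2 * (cheb n).[mu] + bt) * vi) = 1].
Proof.
(* Modulo [t] the constant coefficient of [bs_eqn] is 0 and the linear one is 1. *)
have [||mu mu0 Emu] := @fps_hensel _ bs_eqn.
- by rewrite coef_bs_eqn !subr0 sub0r fpsNE z2M0 oppr0.
- rewrite coef_bs_eqn coefC subr0 !fpsBE fpsM0 om0 mul1r cheb0_0 fpsDE bt0 z2M0.
  by rewrite mulrnAl fps_mulrnE z2M0 mul0rn addr0 !subr0.
have vN0 : (cheb N).[mu] 0%N = 1 by rewrite horner_fps0 // cheb0_0.
have [vi Hvi] := fps_inv_exists vN0.
set vN := (cheb N).[mu] in Hvi vN0; set vn := (cheb n).[mu].
pose br := vN * om - vN * mu - (z ^+ 2 *+ 2 * vn + bt).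
have br0 : br 0%N = 1.
  rewrite /br !fpsBE !fpsM0 om0 vN0 mu0 fpsDE bt0 mulrnAl fps_mulrnE z2M0.
  by rewrite mul0rn mulr0 mulr1 addr0 !subr0.
have [g Hg] := fps_inv_exists br0.
(* As [br] is invertible, this form of the equation shows that [mu] is divisible by [z ^+ 2]. *)
have Ebr : mu * br = z ^+ 2 * vN.
  apply/eqP; rewrite -subr_eq0; apply/eqP; rewrite -[RHS]Emu horner_bs_eqn.
  by rewrite -/vN -/vn /br; move: om bt (z ^+ 2) => o b y; ring.
pose m := vN * g.
have Emu' : mu = z ^+ 2 * m.
  by rewrite -[LHS]mulr1 -Hg /m mulrA Ebr mulrA.
have [hi Hhi] : exists hi, (1 - z ^+ 2 * m ^+ 2) * hi = 1.
  by apply: fps_inv_exists; rewrite fpsBE z2M0 subr0.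
exists m, vi, hi; rewrite /= -Emu'; split=> //.
- by rewrite /bs_poly hornerM Emu mulr0.
- rewrite /bs_poly derivM derivC mul0r add0r hornerM hornerC.
  apply/eqP => /(congr1 (fun f : A => f 0%N)).
  rewrite fpsM0 horner_fps0 // coef_deriv mulr1n.
  rewrite coef_bs_eqn coefC subr0 !fpsBE fpsM0 om0 mul1r cheb0_0 fpsDE bt0 z2M0.
  rewrite mulrnAl fps_mulrnE z2M0 mul0rn addr0 !subr0 mulr1 fpsNE fps0E.
  rewrite /fps_rat /fps_const mulr1n => /eqP; rewrite oppr_eq0 polyC_eq0 invr_eq0.
  by apply/negP; rewrite expf_neq0.
- have -> : om - mu - (z ^+ 2 *+ 2 * vn + bt) * vi = br * vi.
    transitivity ((om - mu) * (vN * vi) - (z ^+ 2 *+ 2 * vn + bt) * vi).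
      by rewrite Hvi mulr1.
    by rewrite /br; move: om bt (z ^+ 2) => o b y; ring.
  by rewrite /m mulrA -[_ * _ * br]mulrA [g * _]mulrC Hg mulr1.
Qed.

End GreenFunction.

Lemma big_letter (V : nmodType) (F : letter bs_gen -> V) :
  \sum_x F x = F (bs_a, false) + F (bs_a, true) + (F (bs_b, false) + F (bs_b, true)).
Proof.
rewrite (reindex (fun p : bool * bool => (bs_gen_of_bool p.1, p.2))) /=; last first.
  by exists (fun x : letter bs_gen => (bool_of_bs_gen x.1, x.2)) => -[[] []].
rewrite -(pair_bigA _ (fun x y => F (bs_gen_of_bool x, y))) /= !big_bool /=.
by rewrite addrC ![F (_, true) + _]addrC.
Qed.

(** One plus the exponent of [a]: negative powers of [u] are avoided, and exponent sum 0 becomes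
    equality of the exponents of [u] and [t]. *)
Definition letter_wt (x : letter bs_gen) : nat :=
  if x.1 is bs_a then (if x.2 then 0%N else 2%N) else 1%N.

(** * The Green function of the quotient *)

Section Green.
Local Notation A := (fps {poly rat}).
Local Notation t := (fps_t : A).
Local Notation u := fps_u.
Local Notation z := (fps_t * fps_u : A).
Variables (w : rat) (n : nat).
Local Notation N := n.+1.
Local Notation om := (1 + fps_rat w * (fps_t * fps_u) ^+ 2 : A).
Local Notation bt := (t ^+ N * (1 + u ^+ (2 * N))).

(** For [w = 0], [Phi q] counts walks from [q] to the identity. Such a walk undoes the syllables of
    [q] one after the other, so [Phi q] is a product over them. The value [m / (1 - z^2 m^2)] at the
    identity is expressed through [mu], which satisfies the monic equation. *)
Lemma bs_green : exists (m : A) (Phi : bs_state -> A), let mu := z ^+ 2 * m in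
  [/\ (bs_poly w n).[mu] = 0, (bs_poly w n)^`().[mu] != 0,
      (z ^+ 2 - mu ^+ 2) * Phi bs_one = mu, z ^+ 2 - mu ^+ 2 != 0 &
      forall q, bs_valid N q ->
        om * Phi q - t * \sum_x u ^+ letter_wt x * Phi (bs_step N q x)
          = (q == bs_one)%:R].
Proof.
have [m [vi [hi /=]]] := bs_root w n; set mu := z ^+ 2 * m.
move=> [Pmu dPmu Hvi Hhi Hm]; pose v k := (cheb w k).[mu].
(* For [w = 0], the passage from residue [r] to residue 0 along a cycle of [a]-edges. It solves the
   linear recurrence [ArS] with value 1 at [0] and [N]; there [mu *+ 2] stands for excursions
   through the two [b]-edges. *)
pose Ar r := (t ^+ r * v (N - r)%N + (t * u ^+ 2) ^+ (N - r) * v r) * vi.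
have v0 : v 0%N = 0 by rewrite /v horner0.
have v1 : v 1%N = 1 by rewrite /v hornerC.
have Ar0 : Ar 0%N = 1 by rewrite /Ar subn0 v0 mulr0 addr0 mul1r.
have ArN : Ar N = 1 by rewrite /Ar subnn v0 mulr0 add0r mul1r.
have ArS r : (r.+1 < N)%N ->
    (om - mu *+ 2) * Ar r.+1 = t * u ^+ 2 * Ar r.+2 + t * Ar r.
  move=> lt_rN; have [k [E0 E1 E2]] :
      exists k, [/\ N - r = k.+2, N - r.+1 = k.+1 & N - r.+2 = k]%N.
    by exists (N - r.+2)%N; split; lia.
  rewrite /Ar E0 E1 E2.
  have vk : v k.+2 = (om - mu *+ 2) * v k.+1 - z ^+ 2 * v k by exact: horner_chebSS.
  have vr : v r.+2 = (om - mu *+ 2) * v r.+1 - z ^+ 2 * v r by exact: horner_chebSS.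
  rewrite vk vr [t ^+ r.+2]exprS [t ^+ r.+1]exprS.
  rewrite [(t * u ^+ 2) ^+ k.+2]exprS [(t * u ^+ 2) ^+ k.+1]exprS.
  by move: om (t ^+ r) ((t * u ^+ 2) ^+ k) => o tr Uk; ring.
have B : t * u ^+ 2 * Ar 1%N + t * Ar n = (z ^+ 2 *+ 2 * v n + bt) * vi.
  rewrite /Ar subSS subn0 (_ : N - n = 1)%N ?v1; last by lia.
  have -> : bt = t ^+ N + (t * u ^+ 2) ^+ N by rewrite mulrDr mulr1 exprM -exprMn.
  rewrite [t ^+ N]exprS [(t * u ^+ 2) ^+ N]exprS.
  by move: (t ^+ n) ((t * u ^+ 2) ^+ n) => tn Un; ring.
(* At the identity both [b]-edges lead outwards, which turns the equation for [m] into
   [H * (1 / m - mu) = 1]. *)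
pose H := m * hi.
pose Phi (q : bs_state) := Ar q.1 * \prod_(p <- q.2) (z * m * Ar p.2) * H.
have Phi_push e r s : Phi (0%N, (e, r) :: s) = z * m * Phi (r, s).
  by rewrite /Phi big_cons /= Ar0; ring.
have Hm' : m * (om - mu - (t * u ^+ 2 * Ar 1%N + t * Ar n)) = 1 by rewrite B.
exists m, Phi; rewrite -/mu; split => //.
- have -> : (z ^+ 2 - mu ^+ 2) * Phi bs_one
      = z ^+ 2 * m * ((1 - z ^+ 2 * m ^+ 2) * hi).
    by rewrite /Phi /= big_nil Ar0 /H /mu; ring.
  by rewrite Hhi mulr1.
- have -> : z ^+ 2 - mu ^+ 2 = t ^+ 2 * (u ^+ 2 * (1 - z ^+ 2 * m ^+ 2)).
    by rewrite /mu; ring.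
  apply/eqP => /(congr1 (fun f : A => f 2%N)); rewrite fps_tXME /= /u -rmorphXn.
  rewrite fpsCM fpsBE z2M0 subr0 mulr1 => /eqP.
  by rewrite fps0E expf_eq0 /= polyX_eq0.
- case=> r s Hq; rewrite big_letter /letter_wt /= expr0 expr1 mul1r.
  have lt_rN := bs_valid_lt Hq.
  have PhiA r' r'' : Ar r' = Ar r'' -> Phi (r', s) = Phi (r'', s).
    by rewrite /Phi /= => ->.
  have PhiE r' : Phi (r', s) = Ar r' * Phi (0%N, s) by rewrite /Phi /= Ar0; ring.
  have -> : Phi (if r.+1 == N then 0%N else r.+1, s) = Phi (r.+1, s).
    by apply: PhiA; case: eqP => // ->; rewrite ArN.
  case: r Hq lt_rN => [|r] Hq lt_rN /=; last first.
    rewrite !Phi_push.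
    rewrite (PhiE r.+2) (PhiE r) (PhiE r.+1).
    have -> : om * (Ar r.+1 * Phi (0%N, s)) -
       t * (u ^+ 2 * (Ar r.+2 * Phi (0%N, s)) + Ar r * Phi (0%N, s) +
         (u * (z * m * (Ar r.+1 * Phi (0%N, s))) + u * (z * m * (Ar r.+1 * Phi (0%N, s)))))
      = ((om - mu *+ 2) * Ar r.+1 - (t * u ^+ 2 * Ar r.+2 + t * Ar r)) * Phi (0%N, s).
      by rewrite /mu; move: om => o; ring.
    by rewrite ArS // subrr mul0r.
  rewrite (PhiE 1%N) (PhiE n).
  case: s Hq {lt_rN} PhiE PhiA => [|[e r'] s] Hq PhiE PhiA.
    rewrite !Phi_push eqxx.
    have E0 : Phi bs_one = H by rewrite /Phi /= big_nil Ar0 !mul1r.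
    rewrite -[(0%N, [::])]/bs_one E0.
    transitivity (hi * (m * (om - mu - (t * u ^+ 2 * Ar 1%N + t * Ar n)) - m * mu)).
      by rewrite /H /mu; move: om => o; ring.
    by rewrite Hm' -[RHS]Hhi /mu; ring.
  have -> : u * Phi (if e == true then (r', s) else (0%N, (false, 0%N) :: (e, r') :: s)) +
     u * Phi (if e == false then (r', s) else (0%N, (true, 0%N) :: (e, r') :: s)) =
     u * Phi (r', s) + u * (z * m * (z * m * Phi (r', s))).
    by case: e {Hq PhiE PhiA} => /=; rewrite !Phi_push // addrC.
  rewrite Phi_push.
  transitivity (z * Phi (r', s) * (m * (om - mu - (t * u ^+ 2 * Ar 1%N + t * Ar n)) - 1)).
    by rewrite /mu; move: om => o; ring.
  by rewrite Hm' subrr mulr0.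
Qed.

End Green.

Lemma big_tuple_cons (V : nmodType) (T : finType) k (P : pred (seq T)) (F : seq T -> V) :
  \sum_(w : k.+1.-tuple T | P w) F w =
  \sum_(x : T) \sum_(w : k.-tuple T | P (x :: w)) F (x :: w).
Proof.
rewrite pair_big_dep /= (reindex (fun p : T * k.-tuple T => [tuple of p.1 :: p.2])) //=.
exists (fun w : k.+1.-tuple T => (thead w, [tuple of behead w])) => [[x w] _|w _] /=.
  by congr (_, _); apply: val_inj.
by rewrite -tuple_eta.
Qed.

(** * Generating polynomials of walks and of reduced walks *)

Section Counting.
Local Notation A := (fps {poly rat}).
Local Notation L := (letter bs_gen).
Local Notation t := (fps_t : A).
Local Notation u := fps_u.
Local Notation z := (fps_t * fps_u : A).
Variable N : nat.
Hypothesis N_gt0 : (0 < N)%N.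
Implicit Types (x y : L) (q : bs_state) (k : nat).

Definition word_wt (w : seq L) : nat := \sum_(x <- w) letter_wt x.

Lemma word_wt_cons x w : word_wt (x :: w) = (letter_wt x + word_wt w)%N.
Proof. exact: big_cons. Qed.

Lemma word_wt_aexp (w : seq L) : (word_wt w)%:Z = (size w)%:Z + aexp w.
Proof.
elim: w => [|x w IH]; first by rewrite /word_wt /aexp !big_nil.
rewrite word_wt_cons PoszD IH /aexp big_cons /= -addn1 PoszD.
by case: x => -[] []; rewrite /letter_wt /letter_aexp /=; ring.
Qed.

Lemma letter_wt_inv x : (letter_wt x + letter_wt (inv_letter x) = 2)%N.
Proof. by case: x => -[] []. Qed.

Definition returns q (w : seq L) : bool := foldl (bs_step N) q w == bs_one.

Definition walk_poly k q : {poly rat} :=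
  \sum_(w : k.-tuple L | returns q w) 'X^(word_wt w).

Definition reduced_walk_poly k q : {poly rat} :=
  \sum_(w : k.-tuple L | freely_reduced w && returns q w) 'X^(word_wt w).

(** Being reduced needs a memory of one letter; the recursion for [reduced_walk_poly] eliminates it
    again. *)
Definition reduced_after_poly k x q : {poly rat} :=
  \sum_(w : k.-tuple L | freely_reduced (x :: w) && returns q w) 'X^(word_wt w).

Lemma big_tuple0 (V : nmodType) (T : finType) (P : pred (seq T)) (F : seq T -> V) :
  \sum_(w : 0.-tuple T | P w) F w = if P [::] then F [::] else 0.
Proof.
rewrite (eq_bigl (fun w : 0.-tuple T => P [::])) => [|w]; last by rewrite tuple0.
case: (P [::]); last by rewrite big_pred0_eq.
by rewrite (big_pred1 [tuple]) // => w; apply/esym/eqP; exact: tuple0.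
Qed.

Lemma walk_poly0 q : walk_poly 0 q = (q == bs_one)%:R.
Proof.
rewrite /walk_poly (big_tuple0 (returns q) (fun w => 'X^(word_wt w))) /returns /=.
by rewrite /word_wt big_nil expr0; case: eqP.
Qed.

Lemma walk_polyS k q :
  walk_poly k.+1 q = \sum_x 'X^(letter_wt x) * walk_poly k (bs_step N q x).
Proof.
rewrite /walk_poly (big_tuple_cons _ (returns q) (fun w => 'X^(word_wt w))).
apply: eq_bigr => x _; rewrite mulr_sumr; apply: eq_bigr => w _.
by rewrite word_wt_cons exprD.
Qed.

Lemma reduced_after_poly0 x q : reduced_after_poly 0 x q = (q == bs_one)%:R.
Proof.
rewrite /reduced_after_poly (big_tuple0
  (fun w => freely_reduced (x :: w) && returns q w) (fun w => 'X^(word_wt w))).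
by rewrite /returns /= /word_wt big_nil expr0; case: eqP.
Qed.

Lemma reduced_walk_poly0 q : reduced_walk_poly 0 q = (q == bs_one)%:R.
Proof.
rewrite /reduced_walk_poly (big_tuple0
  (fun w => freely_reduced w && returns q w) (fun w => 'X^(word_wt w))).
by rewrite /returns /= /word_wt big_nil expr0; case: eqP.
Qed.

Lemma reduced_walk_polyS k q : reduced_walk_poly k.+1 q =
  \sum_x 'X^(letter_wt x) * reduced_after_poly k x (bs_step N q x).
Proof.
rewrite /reduced_walk_poly (big_tuple_cons _
  (fun w => freely_reduced w && returns q w) (fun w => 'X^(word_wt w))).
apply: eq_bigr => x _; rewrite mulr_sumr; apply: eq_bigr => w _.
by rewrite word_wt_cons exprD.
Qed.

Lemma reduced_after_polyS k x q : bs_valid N q ->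
  reduced_after_poly k.+1 x q = reduced_walk_poly k.+1 q
    - 'X^(letter_wt (inv_letter x))
      * reduced_after_poly k (inv_letter x) (bs_step N q (inv_letter x)).
Proof.
move=> Hq; rewrite reduced_walk_polyS (bigD1 (inv_letter x)) //= addrC addrK.
rewrite /reduced_after_poly (big_tuple_cons _
  (fun w => freely_reduced (x :: w) && returns q w) (fun w => 'X^(word_wt w))).
rewrite (bigD1 (inv_letter x)) //= big1 ?add0r; last first.
  by move=> w; rewrite /= eqxx.
apply: eq_bigr => y neq_y; rewrite mulr_sumr; apply: eq_big => [w|w _].
  by rewrite /= neq_y.
by rewrite word_wt_cons exprD.
Qed.

Lemma sum_inv_letter (V : nmodType) (F : L -> V) :
  \sum_x F (inv_letter x) = \sum_x F x.
Proof.
rewrite [RHS](reindex_inj (h := @inv_letter bs_gen)) //.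
exact: can_inj (@inv_letterK).
Qed.

(** A nonempty reduced word may follow any letter but the inverse of its first one, which leaves 3;
    the empty word may follow all 4. *)
Lemma sum_reduced_after k q : bs_valid N q ->
  \sum_x reduced_after_poly k x q =
    reduced_walk_poly k q *+ (if k is 0%N then 4 else 3).
Proof.
move=> Hq; case: k => [|k].
  by rewrite big_letter !reduced_after_poly0 reduced_walk_poly0 -!mulr2n -mulrnA.
under eq_bigr do rewrite reduced_after_polyS //.
rewrite sumrB.
rewrite (sum_inv_letter (fun x => 'X^(letter_wt x) *
  reduced_after_poly k x (bs_step N q x))) -reduced_walk_polyS.
by rewrite big_letter -!mulr2n -mulrnA [_ *+ (2 * 2)]mulrSr addrK.
Qed.

(** From the words [x w] with [w] reduced, those where [w] starts with the inverse of [x] are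
    removed; there the first two steps return to [q] with weight [u^2]. *)
Lemma reduced_walk_polySS k q : bs_valid N q ->
  reduced_walk_poly k.+2 q =
    \sum_x 'X^(letter_wt x) * reduced_walk_poly k.+1 (bs_step N q x)
    - 'X^2 * reduced_walk_poly k q *+ (if k is 0%N then 4 else 3).
Proof.
move=> Hq; rewrite reduced_walk_polyS.
under eq_bigr => x _.
  rewrite reduced_after_polyS; last exact: bs_step_valid.
  rewrite bs_stepK // mulrBr mulrA -exprD letter_wt_inv.
over.
rewrite sumrB; congr (_ - _).
rewrite (sum_inv_letter (fun x => 'X^2 * reduced_after_poly k x q)).
by rewrite -mulr_sumr sum_reduced_after // mulrnAr.
Qed.

(** * Uniqueness of the solution of the Green equation *)

Section Uniqueness.
Variables (w : rat) (c : A) (Phi : bs_state -> A).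
Local Notation om := (1 + fps_rat w * (fps_t * fps_u) ^+ 2 : A).
Hypothesis green : forall q, bs_valid N q ->
  om * Phi q - t * \sum_x u ^+ letter_wt x * Phi (bs_step N q x) = c *+ (q == bs_one).

Let stepsum k q := \sum_x 'X^(letter_wt x) * Phi (bs_step N q x) k.

Let coef_sum_step q k :
  (\sum_x u ^+ letter_wt x * Phi (bs_step N q x)) k = stepsum k q.
Proof.
by rewrite fps_sumE; apply: eq_bigr => x _; rewrite -rmorphXn fpsCM.
Qed.

Lemma coef_z2M (f : A) k : (z ^+ 2 * f) k = if k is k'.+2 then 'X^2 * f k' else 0.
Proof.
rewrite exprMn -mulrA fps_tXME -rmorphXn fpsCM.
by case: k => [|[|k]] //; rewrite subn2.
Qed.

Let coef_omM (f : A) k : (om * f) k = f k + w%:P * (z ^+ 2 * f) k.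
Proof. by rewrite mulrDl mul1r fpsDE -mulrA fpsCM. Qed.

Let green0 q : bs_valid N q -> Phi q 0%N = c 0%N *+ (q == bs_one).
Proof.
move=> /green/(congr1 (fun f : A => f 0%N)).
by rewrite fpsBE coef_omM coef_z2M fps_tM0 fps_mulrnE mulr0 addr0 subr0.
Qed.

Let green1 q : bs_valid N q -> Phi q 1%N = stepsum 0 q + c 1%N *+ (q == bs_one).
Proof.
move=> /green/(congr1 (fun f : A => f 1%N)).
rewrite fpsBE coef_omM coef_z2M fps_tMS coef_sum_step fps_mulrnE mulr0 addr0.
by move=> <-; rewrite addrC subrK.
Qed.

Let greenSS q k : bs_valid N q ->
  Phi q k.+2 = stepsum k.+1 q - w%:P * ('X^2 * Phi q k) + c k.+2 *+ (q == bs_one).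
Proof.
move=> /green/(congr1 (fun f : A => f k.+2)).
rewrite fpsBE coef_omM coef_z2M fps_tMS coef_sum_step fps_mulrnE => <-.
by ring.
Qed.

Lemma green_walk q k : w = 0 -> c = 1 -> bs_valid N q -> Phi q k = walk_poly k q.
Proof.
move=> w0 c1; elim: k q => [|k IH] q Hq; first by rewrite green0 // walk_poly0 c1.
have -> : Phi q k.+1 = stepsum k q.
  case: k {IH} => [|k]; first by rewrite green1 // c1 mul0rn addr0.
  by rewrite greenSS // w0 polyC0 mul0r subr0 c1 mul0rn addr0.
rewrite walk_polyS; apply: eq_bigr => x _; rewrite IH //; exact: bs_step_valid.
Qed.

(** The factor 3 of the recursion is the coefficient of [z ^+ 2] in [om]; the exceptional 4 at the
    empty word comes from the term [- z ^+ 2] of [c]. *)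
Lemma green_reduced q k : w = 3 -> c = 1 - z ^+ 2 -> bs_valid N q ->
  Phi q k = reduced_walk_poly k q.
Proof.
move=> w3 cE.
have cnE i : c i = (i == 0%N)%:R - (if i == 2%N then 'X^2 else 0).
  rewrite cE fpsBE -[z ^+ 2]mulr1 coef_z2M fps1E.
  by case: i => [|[|[|i]]]; rewrite /fps_const /= ?mulr1 ?mulr0n ?mulr0.
have w3E (p : {poly rat}) : w%:P * p = p *+ 3 by rewrite w3 -[3]/(3%:R) polyC_natr mulr_natl.
elim/ltn_ind: k q => -[|[|k]] IH q Hq.
- by rewrite green0 // cnE subr0 reduced_walk_poly0; case: eqP.
- rewrite green1 // cnE subrr mul0rn addr0 reduced_walk_polyS; apply: eq_bigr => x _.
  by rewrite reduced_after_poly0 -reduced_walk_poly0 IH //; exact: bs_step_valid.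
rewrite reduced_walk_polySS // greenSS // w3E IH //.
have -> : stepsum k.+1 q =
    \sum_x 'X^(letter_wt x) * reduced_walk_poly k.+1 (bs_step N q x).
  by apply: eq_bigr => x _; rewrite IH //; exact: bs_step_valid.
rewrite -addrA; congr (_ + _); case: k IH => [|k] IH.
  rewrite reduced_walk_poly0 cnE sub0r; case: eqP => _ /=; ring.
by rewrite cnE subrr mul0rn addr0.
Qed.

End Uniqueness.

(** By the solution of the word problem a word is trivial iff it returns and has exponent sum 0, and
    the latter says that its weight equals its length. *)
Lemma count_coef (P : pred (seq L)) k :
  (\sum_(w : k.-tuple L | P w && returns bs_one w) 'X^(word_wt w) : {poly rat})`_k =
  #|[set w : k.-tuple L | P w && `[< represents_identity (bs_rel N) w >]]|%:R.
Proof.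
rewrite coef_sum -sum1_card natr_sum.
rewrite [RHS](eq_bigl (fun w : k.-tuple L => (P w && returns bs_one w) && (word_wt w == k))).
  rewrite [RHS]big_mkcondr; apply: eq_bigr => w _.
  by rewrite coefXn eq_sym; case: eqP.
move=> w; rewrite inE -andbA; congr (_ && _); apply/asboolP/andP.
  move=> /(represents_identityP N_gt0)[/eqP rw ew]; split=> //.
  by have := word_wt_aexp w; rewrite ew addr0 size_tuple => -[/eqP].
move=> [/eqP rw /eqP ew]; apply/(represents_identityP N_gt0); split=> //.
have := word_wt_aexp w; rewrite ew size_tuple => H.
by apply: (addrI k%:Z); rewrite -H addr0.
Qed.

End Counting.

(** * D-finiteness of both counting series *)

Section BSDFinite.
Variable N : nat.
Hypothesis N_gt0 : (1 <= N)%N.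
Local Notation A := (fps {poly rat}).
Local Notation z := (fps_t * fps_u : A).

(** The Green function multiplied by [c] solves the equation with right-hand side [c], so [f] is
    [c * mu / (z ^+ 2 - mu ^+ 2)]. *)
Lemma bs_diagonal_D_finite (w : rat) (c f : A) :
  (forall m : A, let mu := z ^+ 2 * m in
    gen_by [:: fps_t; fps_u; mu] (c * mu)) ->
  (forall Phi : bs_state -> A,
    (forall q, bs_valid N q ->
      (1 + fps_rat w * z ^+ 2) * Phi q -
        fps_t * \sum_x fps_u ^+ letter_wt x * Phi (bs_step N q x) = c *+ (q == bs_one)) ->
    f = Phi bs_one) ->
  D_finite (fun k => (f k)`_k).
Proof.
case: N N_gt0 => // n _ Hc Hf.
have [m [Phi [Pmu dPmu Phi1 den0 green]]] := bs_green w n.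
have z1 : gen_by [:: fps_t; fps_u; z ^+ 2 * m] z.
  by apply: gen_by_sub z_gen => x; rewrite !inE orbA => ->.
apply: (@algebraic_diagonal_D_finite _ _ _ _ (c * (z ^+ 2 * m))
  (z ^+ 2 - (z ^+ 2 * m) ^+ 2) Pmu (bs_poly_monic w n) (size_bs_poly w n)) => //.
- exact: filt_bs_poly.
- by apply: gen_byB; apply: gen_byX => //; apply: gen_by_mem; rewrite !inE eqxx !orbT.
rewrite (Hf (fun q => c * Phi q)) => [|q Hq]; first by rewrite mulrCA Phi1.
rewrite -[in RHS](mulr1 c) -mulrnAr -green // mulrBr mulrCA; congr (_ - _).
rewrite mulrCA; congr (_ * _); rewrite mulr_sumr; apply: eq_bigr => x _.
exact: mulrCA.
Qed.

Lemma count_identity_D_finite :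
  D_finite (fun k => (count_identity (bs_rel N) k)%:R : rat).
Proof.
pose f : A := fun k => walk_poly N k bs_one.
have -> : (fun k => (count_identity (bs_rel N) k)%:R : rat) = (fun k => (f k)`_k).
  by apply/funext => k; rewrite /f /walk_poly (count_coef N_gt0 xpredT).
apply: (@bs_diagonal_D_finite 0 1) => [m|Phi green].
  by rewrite /= mul1r; apply: gen_by_mem; rewrite !inE eqxx !orbT.
by apply: fpsP => k; rewrite (green_walk N_gt0 green) //; exact: bs_one_valid.
Qed.

Lemma count_reduced_identity_D_finite :
  D_finite (fun k => (count_reduced_identity (bs_rel N) k)%:R : rat).
Proof.
pose f : A := fun k => reduced_walk_poly N k bs_one.
have -> : (fun k => (count_reduced_identity (bs_rel N) k)%:R : rat) = (fun k => (f k)`_k).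
  by apply/funext => k; rewrite /f /reduced_walk_poly (count_coef N_gt0 (@freely_reduced _)).
apply: (@bs_diagonal_D_finite 3 (1 - z ^+ 2)) => [m|Phi green].
  apply: gen_byM; last by apply: gen_by_mem; rewrite !inE eqxx !orbT.
  apply: gen_byB; first exact: gen_by1.
  by apply/gen_byX/(gen_by_sub _ z_gen) => x; rewrite !inE orbA => ->.
by apply: fpsP => k; rewrite (green_reduced N_gt0 green) //; exact: bs_one_valid.
Qed.

End BSDFinite.

(** * Growth rates of D-finite sequences *)

Section LimsupRoot.
Variable R : realType.
Local Open Scope classical_set_scope.
Implicit Types (e : nat -> \bar R) (y : R).

Lemma limn_esup_lt e y : (limn_esup e < y%:E)%E ->
  exists n0, forall n, (n0 <= n)%N -> (e n <= y%:E)%E.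
Proof.
rewrite /limn_esup /limf_esup => /ereal_inf_lt[_ [V [n0 _ Vn0] <-] lt_y].
exists n0 => n le_n; apply: le_trans (ltW lt_y).
by apply: ereal_sup_ubound; exists n => //; exact: Vn0.
Qed.

Lemma limn_esup_le e y n0 : (forall n, (n0 <= n)%N -> (e n <= y%:E)%E) ->
  (limn_esup e <= y%:E)%E.
Proof.
move=> He; apply: (@le_trans _ _ (ereal_sup [set e n | n in [set n | (n0 <= n)%N]])).
  by apply: ereal_inf_lbound; exists [set n | (n0 <= n)%N] => //; exists n0.
by apply: ge_ereal_sup => _ [n le_n <-]; exact: He.
Qed.

Lemma powR_root_le (c s : R) n : 0 <= c -> 0 <= s -> (0 < n)%N ->
  (c `^ (n%:R^-1) <= s) = (c <= s ^+ n).
Proof.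
move=> c0 s0 n0; have rootK (x : R) : 0 <= x -> (x `^ (n%:R^-1)) ^+ n = x.
  by move=> x0; rewrite -powR_mulrn ?powR_ge0 // -powRrM mulVf ?pnatr_eq0 -?lt0n // powRr1.
by rewrite -[in RHS](rootK c c0) ler_pXn2r // nnegrE ?powR_ge0.
Qed.

Lemma exprn_unbounded (q C : R) : 1 < q ->
  exists n0, forall n, (n0 <= n)%N -> C <= q ^+ n.
Proof.
move=> q1; have q1_gt0 : 0 < q - 1 by rewrite subr_gt0.
have bern n : 1 + (q - 1) *+ n <= q ^+ n.
  elim: n => [|n IH]; first by rewrite mulr0n addr0.
  rewrite exprS; apply: (@le_trans _ _ (q * (1 + (q - 1) *+ n))).
    have := mulrn_wge0 n (ltW q1_gt0); rewrite mulrSr.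
    by move: (_ *+ n) => m m0; nra.
  by rewrite ler_pM2l // (lt_trans ltr01).
exists (Num.bound `|C / (q - 1)|) => n le_n; apply: le_trans (bern n).
have lt_C : C / (q - 1) < n%:R.
  apply: le_lt_trans (ler_norm _) _; apply: lt_le_trans (archi_boundP (normr_ge0 _)) _.
  by rewrite ler_nat.
by rewrite -mulr_natr; move: lt_C; rewrite ltr_pdivrMr //; nra.
Qed.

End LimsupRoot.

(** * Re-expansion of a power series at a real point *)

Section Singularity.
Variable R : realType.
Local Open Scope classical_set_scope.
Implicit Types (f g a : fps R) (p P : {poly R}) (x : R).

Definition fps_of_poly p : fps R := fun i => p`_i.

Lemma fps_of_polyD p P : fps_of_poly (p + P) = fps_of_poly p + fps_of_poly P.
Proof. by apply: fpsP => n; rewrite /fps_of_poly coefD. Qed.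
Lemma fps_of_polyM p P : fps_of_poly (p * P) = fps_of_poly p * fps_of_poly P.
Proof. by apply: fpsP => n; rewrite /fps_of_poly coefM. Qed.
Lemma fps_of_polyC (c : R) : fps_of_poly c%:P = fps_const c.
Proof. by apply: fpsP => -[|n]; rewrite /fps_of_poly coefC. Qed.
Lemma fps_of_polyX : fps_of_poly 'X = fps_t.
Proof. by apply: fpsP => n; rewrite /fps_of_poly coefX. Qed.

(** Partial sums of the series for [f^(k)(x) / k!]. Where [i - k] is truncated, the binomial
    coefficient is 0. *)
Definition taylor_sum x k f : R ^nat :=
  fun n => \sum_(i < n) (f i * x ^+ (i - k)) *+ 'C(i, k).

Definition taylor x f a : Prop := forall k, taylor_sum x k f @ \oo --> a k.

Lemma taylorD x f g a b : taylor x f a -> taylor x g b -> taylor x (f + g) (a + b).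
Proof.
move=> Hf Hg k; have -> : taylor_sum x k (f + g) = taylor_sum x k f \+ taylor_sum x k g.
  apply/funext => n; rewrite /taylor_sum /= -big_split; apply: eq_bigr => i _.
  by rewrite fpsDE mulrDl mulrnDl.
exact: cvgD (Hf k) (Hg k).
Qed.

Lemma taylorZ x c f a : taylor x f a -> taylor x (fps_const c * f) (fps_const c * a).
Proof.
move=> Hf k; rewrite fpsCM.
have -> : taylor_sum x k (fps_const c * f) = (fun n => c * taylor_sum x k f n).
  apply/funext => n; rewrite /taylor_sum mulr_sumr; apply: eq_bigr => i _.
  by rewrite fpsCM mulrnAr mulrA.
by apply: cvgM => //; exact: cvg_cst.
Qed.

Lemma taylor0 x : taylor x 0 0.
Proof.
move=> k; rewrite [taylor_sum _ _ _](_ : _ = fun=> 0); first exact: cvg_cst.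
by apply/funext => n; rewrite /taylor_sum big1 // => i _; rewrite mul0r mul0rn.
Qed.

Lemma taylor_deriv x f a : taylor x f a -> taylor x (fps_deriv f) (fps_deriv a).
Proof.
move=> Hf k; rewrite /fps_deriv -mulr_natr.
have -> : taylor_sum x k (fps_deriv f) = (fun n => taylor_sum x k.+1 f n.+1 * k.+1%:R).
  apply/funext => n; rewrite /taylor_sum big_ord_recl /= bin0n mulr0n add0r mulr_suml.
  apply: eq_bigr => i _; rewrite /fps_deriv /bump /= add1n subSS mulr_natr -mulrnA.
  by rewrite mulnC -mul_bin_diag mulrnA mulrnAl mulrnAC.
apply: cvgM; last exact: cvg_cst.
by have := Hf k.+1; rewrite -cvg_shiftS.
Qed.

Lemma taylor_tM x f a : taylor x f a ->
  taylor x (fps_t * f) ((fps_t + fps_const x) * a).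
Proof.
move=> Hf k; rewrite mulrDl fpsDE fpsCM -cvg_shiftS.
have E n : taylor_sum x k (fps_t * f) n.+1 =
    \sum_(i < n) (f i * x ^+ (i.+1 - k)) *+ 'C(i.+1, k).
  rewrite /taylor_sum big_ord_recl fps_tM0 mul0r mul0rn add0r.
  by apply: eq_bigr => i _; rewrite fps_tMS.
case: k E (Hf k) => [|k] E Hk.
  rewrite fps_tM0 add0r.
  rewrite [X in X @ _ --> _](_ : _ = fun n => x * taylor_sum x 0 f n).
    by apply: cvgM => //; exact: cvg_cst.
  apply/funext => n /=; rewrite E /taylor_sum mulr_sumr; apply: eq_bigr => i _.
  by rewrite !bin0 !subn0 !mulr1n exprS; ring.
rewrite fps_tMS.
rewrite [X in X @ _ --> _](_ : _ = fun n => taylor_sum x k f n + x * taylor_sum x k.+1 f n).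
  by apply: cvgD => //; apply: cvgM => //; exact: cvg_cst.
apply/funext => n /=; rewrite E /taylor_sum mulr_sumr -big_split; apply: eq_bigr => i _ /=.
rewrite binS subSS mulrnDr addrC; congr (_ + _).
case: (ltnP k i) => [lt_ki|le_ik]; last by rewrite bin_small // !mulr0n mulr0.
by rewrite -(subnSK lt_ki) exprS -mulrnAr; ring.
Qed.

Lemma taylor_polyM x P f a : taylor x f a ->
  taylor x (fps_of_poly P * f) (fps_of_poly (P \Po ('X + x%:P)) * a).
Proof.
move=> Hf; elim/poly_ind: P => [|P c IH].
  by rewrite comp_poly0 -polyC0 fps_of_polyC rmorph0 !mul0r; exact: taylor0.
rewrite comp_poly_MXaddC !(fps_of_polyD, fps_of_polyM, fps_of_polyC, fps_of_polyX).
have -> : (fps_of_poly P * fps_t + fps_const c) * f =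
  fps_t * (fps_of_poly P * f) + fps_const c * f by ring.
rewrite mulrDl [_ * (fps_t + _)]mulrC -mulrA.
by apply: taylorD; [exact: taylor_tM|exact: taylorZ].
Qed.

Lemma taylor_unique x f a b : taylor x f a -> taylor x f b -> a = b.
Proof. by move=> Ha Hb; apply: fpsP => k; exact: cvg_unique (Ha k) (Hb k). Qed.

(** Re-expansion at [x] commutes with sums, derivatives and products by polynomials that are
    re-expanded too, and the expansion of 0 is unique. *)
Lemma taylor_ode x d (P : nat -> {poly R}) f a : taylor x f a ->
  \sum_(i < d) fps_of_poly (P i) * iter i (@fps_deriv R) f = 0 ->
  \sum_(i < d) fps_of_poly (P i \Po ('X + x%:P)) * iter i (@fps_deriv R) a = 0.
Proof.
move=> Hf E.
have H : taylor x (\sum_(i < d) fps_of_poly (P i) * iter i (@fps_deriv R) f)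
    (\sum_(i < d) fps_of_poly (P i \Po ('X + x%:P)) * iter i (@fps_deriv R) a).
  elim: d {E} => [|d IH]; first by rewrite !big_ord0; exact: taylor0.
  rewrite !big_ord_recr; apply: taylorD => //; apply: taylor_polyM.
  by elim: (d) => //= i; exact: taylor_deriv.
by rewrite E in H; exact: taylor_unique H (@taylor0 x).
Qed.

(** The binomial theorem for [y = x + (y - x)] gives ['C(i, k) * x ^+ (i - k) * (y - x) ^+ k <= y ^+
    i] for [k <= i], so the increasing partial sums are bounded by [C / (y - x) ^+ k]. *)
Lemma taylor_exists x y f (C : R) : 0 <= x -> x < y -> (forall i, 0 <= f i) ->
  (forall n, \sum_(i < n) f i * y ^+ i <= C) ->
  exists2 a, taylor x f a & forall k n, taylor_sum x k f n <= a k.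
Proof.
move=> x0 xy f0 HC.
have nd k : nondecreasing_seq (taylor_sum x k f).
  apply/nondecreasing_seqP => n; rewrite /taylor_sum big_ord_recr lerDl.
  by rewrite mulrn_wge0 // mulr_ge0 // exprn_ge0.
have yx : 0 < y - x by rewrite subr_gt0.
have cv k : cvgn (taylor_sum x k f).
  apply: nondecreasing_is_cvgn => //; exists (C / (y - x) ^+ k) => _ [n _ <-].
  rewrite ler_pdivlMr ?exprn_gt0 //; apply: le_trans (HC n).
  rewrite /taylor_sum mulr_suml; apply: ler_sum => i _.
  rewrite mulrnAl -mulrA -mulrnAr; apply: ler_wpM2l => //.
  have [lt_k|le_k] := ltnP i k.
    by rewrite bin_small // mulr0n exprn_ge0 // ltW // (le_lt_trans x0).
  have lt_k : (k < i.+1)%N by [].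
  have -> : y ^+ i = (x + (y - x)) ^+ i by congr (_ ^+ _); ring.
  rewrite [(x + _) ^+ i]exprDn (bigD1 (Ordinal lt_k)) //= lerDl sumr_ge0 // => j _.
  by rewrite mulrn_wge0 // mulr_ge0 ?exprn_ge0 // ltW.
exists (fun k => limn (taylor_sum x k f)) => [k|k n]; first exact: cv.
exact: nondecreasing_cvgn_le.
Qed.

End Singularity.

Lemma leq_ffact_add l k i d : (l <= k)%N -> (i <= d)%N ->
  ((l + i) ^_ i <= (k + d) ^_ d)%N.
Proof.
move=> le_lk; elim: i d => [|i IH] [|d] //; first by rewrite ffact_gt0 leq_addl.
by move=> le_id; rewrite !addnS !ffactSS leq_mul // ?IH // ltnS leq_add.
Qed.

(** * Growth of solutions and continuation past a regular point *)

Section GrowthTransfer.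
Variable R : realType.
Implicit Types (f a : fps R) (P Q : nat -> {poly R}) (p : {poly R}) (x : R).

Lemma ode_coef d P f k : \sum_(i < d) fps_of_poly (P i) * iter i (@fps_deriv R) f = 0 ->
  \sum_(i < d) \sum_(j < k.+1) (P i)`_j * (f (k - j + i)%N *+ (k - j + i) ^_ i) = 0.
Proof.
move=> /(congr1 (fun g : fps R => g k)); rewrite fps_sumE fps0E => E; rewrite -[RHS]E.
apply: eq_bigr => i _; rewrite fpsME; apply: eq_bigr => j _; congr (_ * _).
by rewrite fps_derivnE.
Qed.

(** The recurrence is solved for [a (k + d)]. The other indices are smaller and the other falling
    factorials at most [(k + d) ^_ d], so induction gives a rate that depends on [d] and [E]
    only. *)
Lemma recurrence_bound d Q (E : R) a :
  \sum_(i < d.+1) fps_of_poly (Q i) * iter i (@fps_deriv R) a = 0 ->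
  (Q d)`_0 != 0 ->
  (forall i k, (i <= d)%N -> \sum_(j < k) `|(Q i)`_j| <= E * `|(Q d)`_0|) ->
  exists2 C, 0 <= C & forall n, `|a n| <= C * (1 + d.+1%:R * E) ^+ n.
Proof.
move=> ode q0 HE; set q := `|(Q d)`_0|; have q_gt0 : 0 < q by rewrite normr_gt0.
have E0 : 0 <= E.
  by have := HE 0%N 0%N isT; rewrite big_ord0 pmulr_lge0.
set K := 1 + _; have K1 : 1 <= K by rewrite lerDl mulr_ge0.
have K0 : 0 < K by exact: lt_le_trans ltr01 K1.
pose C := \sum_(i < d) `|a i|; have C0 : 0 <= C by exact: sumr_ge0.
exists C => // n; elim/ltn_ind: n => n IH.
have [lt_nd|le_dn] := ltnP n d.
  apply: (@le_trans _ _ C); last by rewrite ler_peMr // exprn_ege1.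
  by rewrite /C (bigD1 (Ordinal lt_nd)) //= lerDl sumr_ge0.
have [k nE] : exists k, n = (k + d)%N by exists (n - d)%N; rewrite subnK.
pose F : R := ((k + d) ^_ d)%:R.
have F_gt0 : 0 < F by rewrite ltr0n ffact_gt0 leq_addl.
pose T i j := (Q i)`_j * (a (k - j + i)%N *+ (k - j + i) ^_ i).
pose B := C * K ^+ n * F.
have B0 : 0 <= B.
  by apply: mulr_ge0; [apply: mulr_ge0 => //; apply: exprn_ge0|]; exact: ltW.
have HT i j : (i <= d)%N -> (j <= k)%N -> (k - j + i < n)%N ->
    `|T i j| * K <= `|(Q i)`_j| * B.
  move=> le_id le_jk lt_n; rewrite normrM -mulrA; apply: ler_wpM2l => //.
  rewrite -mulr_natr normrM normr_nat mulrAC; apply: ler_pM => //.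
  - by rewrite mulr_ge0 // ltW.
  - apply: (@le_trans _ _ (C * K ^+ (k - j + i) * K)).
      by apply: ler_wpM2r; [exact: ltW|exact: IH].
    by rewrite -mulrA -exprSr ler_wpM2l // ler_weXn2l.
  - by rewrite ler_nat leq_ffact_add // leq_subr.
have := ode_coef k ode; rewrite big_ord_recr big_ord_recl /= subn0 -nE => Erec.
pose rest := \sum_(i < d) \sum_(j < k.+1) T i j + \sum_(j < k) T d j.+1.
have {Erec} Etop : `|T d 0%N| = `|rest|.
  move: Erec; rewrite addrCA => /eqP; rewrite addr_eq0 => /eqP.
  by rewrite /T subn0 -nE => ->; rewrite normrN.
have Hrest : `|rest| * K <= d.+1%:R * (E * q) * B.
  rewrite -[d.+1]addn1 natrD !mulrDl mul1r.
  apply: le_trans (ler_wpM2r (ltW K0) (ler_normD _ _)) _; rewrite mulrDl lerD //.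
    apply: le_trans (ler_wpM2r (ltW K0) (ler_norm_sum _ _ _)) _.
    rewrite -mulrA mulr_natl -[d in leRHS]card_ord -sumr_const mulr_suml.
    apply: ler_sum => i _; have le_id : (i <= d)%N by exact: ltnW.
    apply: le_trans (ler_wpM2r (ltW K0) (ler_norm_sum _ _ _)) _.
    apply: le_trans (ler_wpM2r B0 (HE i k.+1 le_id)); rewrite !mulr_suml.
    apply: ler_sum => j _; apply: HT => //; first by rewrite -ltnS.
    by have := ltn_ord i; lia.
  apply: le_trans (ler_wpM2r (ltW K0) (ler_norm_sum _ _ _)) _.
  apply: le_trans (ler_wpM2r B0 (HE d k.+1 (leqnn d))); rewrite big_ord_recl mulrDl.
  apply: (@le_trans _ _ ((\sum_(j < k) `|(Q d)`_j.+1|) * B)); last first.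
    by rewrite lerDr mulr_ge0.
  rewrite !mulr_suml; apply: ler_sum => j _; have := ltn_ord j => lt_jk.
  by apply: HT => //; lia.
rewrite -(ler_pM2r (mulr_gt0 F_gt0 (mulr_gt0 q_gt0 K0))).
have -> : `|a n| * (F * (q * K)) = `|T d 0%N| * K.
  by rewrite /T subn0 -nE normrM -mulr_natr normrM normr_nat nE -/F -/q; ring.
rewrite Etop; apply: le_trans Hrest _.
have -> : C * K ^+ n * (F * (q * K)) = (K * q) * B by rewrite /B; ring.
apply: ler_wpM2r => //; rewrite mulrA; apply: ler_wpM2r; first exact: ltW.
by rewrite /K lerDr.
Qed.

(** This makes the constant [E] of [recurrence_bound] uniform in the expansion point [x]. *)
Lemma shift_coef_bound p (r : R) : 0 <= r -> exists B, forall x k, `|x| <= r ->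
  \sum_(j < k) `|(p \Po ('X + x%:P))`_j| <= B.
Proof.
move=> r0; elim/poly_ind: p => [|p c [B HB]].
  by exists 0 => x k _; rewrite comp_poly0 big1 // => j _; rewrite coef0 normr0.
exists (B + r * B + `|c|) => x k xr; rewrite comp_poly_MXaddC mulrDr.
set S := p \Po _.
have SB l : \sum_(j < l) `|S`_j| <= B by exact: HB.
apply: (@le_trans _ _ (\sum_(j < k) (`|(S * 'X)`_j| + `|x| * `|S`_j| + `|c%:P`_j|))).
  apply: ler_sum => j _; rewrite !coefD coefMC.
  apply: le_trans (ler_normD _ _) _; rewrite lerD2r.
  by apply: le_trans (ler_normD _ _) _; rewrite lerD2l normrM mulrC.
rewrite !big_split /= -mulr_sumr; apply: lerD; first apply: lerD.
- case: k => [|k]; first by rewrite big_ord0; apply: le_trans (SB 0%N); rewrite big_ord0.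
  rewrite big_ord_recl coefMX /= normr0 add0r.
  by under eq_bigr do rewrite coefMX /=; exact: SB.
- by apply: ler_pM; rewrite ?normr_ge0 ?sumr_ge0 //; exact: SB.
- case: k => [|k]; first by rewrite big_ord0.
  rewrite big_ord_recl coefC /= big1 ?addr0 // => j _.
  by rewrite coefC /= normr0.
Qed.

Lemma horner_lower_bound p (r : R) : 0 < r -> p.[r] != 0 ->
  exists eps eta : R, [/\ 0 < eps, 0 < eta & forall x, 0 <= x -> x < r -> r - x < eta ->
    eps <= `|p.[x]|].
Proof.
move=> r0 pr; pose eps := `|p.[r]| / 2.
have eps0 : 0 < eps by rewrite divr_gt0 // normr_gt0.
have /factor_theorem[s Es] : root (p - p.[r]%:P) r.
  by rewrite /root !hornerE subrr.
have [b Hb] := poly_disk_bound s r.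
exists eps, (eps / (1 + `|b|)); have b1 : 0 < 1 + `|b| by rewrite ltr_pwDl.
split=> // [|x x0 xr lt_eta]; first by rewrite divr_gt0.
have Ex : p.[x] = p.[r] + s.[x] * (x - r).
  by have := congr1 (fun g : {poly R} => g.[x]) Es; rewrite !hornerE => <-; ring.
have lex : `|s.[x] * (x - r)| <= eps.
  rewrite normrM distrC (gtr0_norm (_ : 0 < r - x)) ?subr_gt0 //.
  apply: (@le_trans _ _ ((1 + `|b|) * (eps / (1 + `|b|)))).
    apply: ler_pM => //; [by rewrite subr_ge0 ltW| |exact: ltW].
    apply: (@le_trans _ _ b); first by apply: Hb; rewrite ger0_norm // ltW.
    by apply: le_trans (ler_norm b) _; rewrite lerDr.
  by rewrite mulrC divfK // gt_eqF.
have := lerB_normD p.[r] (s.[x] * (x - r)); rewrite -Ex.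
have -> : `|p.[r]| = eps + eps by rewrite /eps; field.
by move: lex; lra.
Qed.

Lemma geometric_sum_le (q : R) n : 0 <= q -> q < 1 -> \sum_(i < n) q ^+ i <= (1 - q)^-1.
Proof.
move=> q0 q1; have q1' : 0 < 1 - q by rewrite subr_gt0.
have E : (1 - q) * \sum_(i < n) q ^+ i = 1 - q ^+ n.
  by rewrite -opprB mulNr -subrX1 opprB.
by rewrite -[leRHS]mul1r ler_pdivlMr // mulrC E gerBl exprn_ge0.
Qed.

(* Pringsheim: if the leading coefficient does not vanish at [r], the Taylor
   coefficients at [x < r] grow geometrically at a rate independent of [x], so
   the series converges beyond [r]. *)
Lemma ode_extension d P f (r : R) :
  \sum_(i < d.+1) fps_of_poly (P i) * iter i (@fps_deriv R) f = 0 ->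
  (forall n, 0 <= f n) -> 0 < r -> (P d).[r] != 0 ->
  (forall y : R, 0 <= y -> y < r -> exists C, forall n, f n * y ^+ n <= C) ->
  exists2 y : R, r < y & exists C, forall n, f n * y ^+ n <= C.
Proof.
move=> ode f0 r0 Pr Hf.
have [eps [eta [eps0 eta0 Heps]]] := horner_lower_bound r0 Pr.
have [b Hb] := choice (fun i => shift_coef_bound (P i) (ltW r0)).
have b0 i : 0 <= b i.
  by have := Hb i 0 0%N; rewrite big_ord0 normr0 => /(_ (ltW r0)).
pose E := (\sum_(i < d.+1) b i) / eps.
have E0 : 0 <= E by rewrite divr_ge0 ?sumr_ge0 // ltW.
pose K := 1 + d.+1%:R * E.
have K1 : 1 <= K by rewrite lerDl mulr_ge0.
have K0 : 0 < K by exact: lt_le_trans ltr01 K1.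
(* At distance [h] a series with coefficients of rate [K] is dominated by a geometric one of ratio
   [1 / 2]. Below, [x] is taken so close to [r] that [x + h] exceeds [r]. *)
pose h := (2 * K)^-1; have h0 : 0 < h by rewrite invr_gt0 mulr_gt0.
have hK : h * K = 2^-1 by rewrite /h invfM mulfVK // gt_eqF.
have [x [x0 xr x_eta x_h]] : exists x, [/\ 0 <= x, x < r, r - x < eta & r - x < h].
  pose m := Num.min r (Num.min eta h); have m0 : 0 < m by rewrite !lt_min r0 eta0 h0.
  have : m <= r /\ (m <= eta /\ m <= h) by rewrite /m !ge_min !lexx !orbT.
  by move=> [? [? ?]]; exists (r - m / 2); split; lra.
pose y := (x + r) / 2; have [xy yr] : x < y /\ y < r by rewrite /y; split; lra.
have [C HC] : exists C, forall n, \sum_(i < n) f i * y ^+ i <= C.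
  (* A bound on the terms at [y'] bounds the partial sums at the smaller [y] by a geometric
     series. *)
  pose y' := (y + r) / 2; have [yy' y'r] : y < y' /\ y' < r by rewrite /y'; split; lra.
  have [|C HC] := Hf y' _ y'r; first by lra.
  have y'0 : 0 < y' by lra.
  have C0 : 0 <= C by apply: le_trans (HC 0%N); rewrite mulr_ge0.
  have q0 : 0 <= y / y' by rewrite divr_ge0 //; lra.
  have q1 : y / y' < 1 by rewrite ltr_pdivrMr // mul1r.
  exists (C * (1 - y / y')^-1) => n.
  apply: le_trans (ler_wpM2l C0 (geometric_sum_le n q0 q1)).
  rewrite mulr_sumr; apply: ler_sum => i _.
  have -> : f i * y ^+ i = (f i * y' ^+ i) * (y / y') ^+ i.
    rewrite [(y / y') ^+ i]expr_div_n -mulrA; congr (_ * _).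
    by rewrite mulrCA mulfV ?mulr1 //; apply: expf_neq0; rewrite gt_eqF.
  by apply: ler_wpM2r => //; exact: exprn_ge0.
have [a Ha le_a] := taylor_exists x0 xy f0 HC.
have odea := taylor_ode Ha ode.
have x_r : `|x| <= r by rewrite ger0_norm // ltW.
have top : (P d \Po ('X + x%:P))`_0 = (P d).[x].
  by rewrite -horner_coef0 horner_comp !hornerE.
have Hx := Heps x x0 xr x_eta.
have [||C' C'0 HC'] := @recurrence_bound d (fun i => P i \Po ('X + x%:P)) E a odea.
- by rewrite top -normr_gt0; exact: lt_le_trans Hx.
- move=> i k le_id; apply: le_trans (Hb i x k x_r) _; rewrite top.
  apply: (@le_trans _ _ (E * eps)); last by apply: ler_wpM2l.
  rewrite /E divfK ?gt_eqF // (bigD1 (Ordinal (le_id : (i < d.+1)%N))) //= lerDl.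
  exact: sumr_ge0.
exists (x + h); first by lra.
exists (C' * (1 - 2^-1)^-1) => n.
have h0' := ltW h0.
(* Expand [(x + h) ^+ i] and exchange the finite sums; by nonnegativity each partial Taylor sum is
   at most its limit [a k]. *)
have step : \sum_(i < n.+1) f i * (x + h) ^+ i <= \sum_(k < n.+1) a k * h ^+ k.
  have -> : \sum_(i < n.+1) f i * (x + h) ^+ i =
      \sum_(k < n.+1) taylor_sum x k f n.+1 * h ^+ k.
    under [RHS]eq_bigr do rewrite /taylor_sum mulr_suml.
    rewrite exchange_big; apply: eq_bigr => i _ /=.
    rewrite exprDn mulr_sumr (big_ord_widen n.+1 (fun j => f i * (x ^+ (i - j) * h ^+ j *+ 'C(i, j)))) //.
    rewrite big_mkcond; apply: eq_bigr => k _.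
    case: ltnP => [_|lt_ik]; last by rewrite bin_small // mulr0n mul0r.
    by rewrite mulrnAr mulrnAl mulrA.
  by apply: ler_sum => k _; apply: ler_wpM2r; [exact: exprn_ge0|exact: le_a].
apply: (@le_trans _ _ (\sum_(i < n.+1) f i * (x + h) ^+ i)).
  rewrite big_ord_recr /= lerDr sumr_ge0 // => i _.
  by rewrite mulr_ge0 // exprn_ge0 // addr_ge0.
apply: (le_trans step); apply: (@le_trans _ _ (\sum_(k < n.+1) C' * 2^-1 ^+ k)).
  apply: ler_sum => k _.
  have -> : C' * 2^-1 ^+ k = C' * K ^+ k * h ^+ k by rewrite -hK exprMn; ring.
  apply: ler_wpM2r; first exact: exprn_ge0.
  by apply: le_trans (ler_norm _) _; exact: HC'.
by rewrite -mulr_sumr; apply: ler_wpM2l => //; apply: geometric_sum_le; lra.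
Qed.

End GrowthTransfer.

(** * Algebraicity of the growth rate *)

Section Growth.
Variable R : realType.
Local Notation toR := (ratr : rat -> R).

(** The equation is cut at its last nonzero coefficient, the polynomial that will have to vanish at
    the singularity. *)
Lemma D_finite_ode (c : nat -> nat) : D_finite (fun n => (c n)%:R : rat) ->
  exists d (p : nat -> {poly rat}), p d != 0 /\
    \sum_(i < d.+1) fps_of_poly (map_poly toR (p i)) *
       iter i (@fps_deriv R) (fun n => (c n)%:R) = 0.
Proof.
move=> [D [p [[i0 pi0] E]]].
pose q i : {poly rat} := if (i < D.+1)%N then p (inord i) else 0.
have qE (i : 'I_D.+1) : q i = p i by rewrite /q ltn_ord inord_val.
have q_big i : q i != 0 -> (i <= D)%N by rewrite /q ltnS; case: leqP => //; rewrite eqxx.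
have exq : exists i, q i != 0 by exists i0; rewrite qE.
case: (ex_maxnP exq q_big) => d qd d_max; exists d, q; split => //.
pose T i : fps R := fps_of_poly (map_poly toR (q i)) *
  iter i (@fps_deriv R) (fun n => (c n)%:R).
rewrite -[LHS]/(\sum_(i < d.+1) T i) (big_ord_widen D.+1 T) ?ltnS ?q_big // big_mkcond /=.
apply: fpsP => n; rewrite fps_sumE fps0E -[RHS](rmorph0 toR) -(E n) rmorph_sum.
apply: eq_bigr => i _; rewrite /poly_mul_fps rmorph_sum /=.
case: ltnP => [_|lt_di]; last first.
  rewrite fps0E big1 // => j _.
  have -> : p i = 0.
    by apply/eqP; rewrite -qE; apply: contraLR lt_di => /d_max; rewrite -leqNgt.
  by rewrite coef0 mul0r rmorph0.
rewrite /T fpsME; apply: eq_bigr => j _; rewrite rmorphM /fps_of_poly coef_map qE.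
congr (_ * _); rewrite fps_derivnE.
transitivity (toR ((c (n - j + i)%N)%:R *+ (n - j + i) ^_ i)).
  by rewrite rmorphMn /= ratr_nat.
by congr (toR _); rewrite fps_derivnE.
Qed.

(** The bound makes the limit superior [l] finite. If [l] is positive, the leading coefficient
    vanishes at [1 / l]; otherwise [ode_extension] would bound the terms beyond the radius of
    convergence. *)
Theorem D_finite_growth_algebraic (c : nat -> nat) B :
  D_finite (fun n => (c n)%:R : rat) -> (forall n, (c n <= B ^ n)%N) ->
  exists2 x : R, algebraicOver toR x &
    limn_esup (fun n => (((c n)%:R : R) `^ (n%:R^-1))%:E) = x%:E.
Proof.
move=> /D_finite_ode[d [p [pd ode]]] cB.
pose e n : \bar R := (((c n)%:R : R) `^ (n%:R^-1))%:E.
rewrite -[limn_esup _]/(limn_esup e); pose f : fps R := fun n => (c n)%:R.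
have f0 n : 0 <= f n by rewrite ler0n.
have root_le n (s : R) : (0 < n)%N -> 0 <= s -> (e n <= s%:E)%E = (f n <= s ^+ n).
  by move=> n0 s0; rewrite lee_fin powR_root_le.
have l_ge0 : (0 <= limn_esup e)%E.
  apply: limf_esup_ge0 => [[n0 _ /(_ n0 (leqnn n0))]|n] //.
  by rewrite lee_fin powR_ge0.
have : (limn_esup e <= (B%:R : R)%:E)%E.
  by apply: (@limn_esup_le _ _ _ 1) => n n1; rewrite root_le // -natrX ler_nat.
case El : (limn_esup e) l_ge0 => [l| |] //; rewrite lee_fin => l_ge0 _.
exists l => //; have [->|l_neq0] := eqVneq l 0; first exact: algebraic0.
have l0 : 0 < l by rewrite lt_neqAle eq_sym l_neq0.
rewrite -[l]invrK; apply: algebraic_inv; set r := l^-1.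
have r0 : 0 < r by rewrite invr_gt0.
exists (p d) => //; apply/negPn/negP => Nroot.
have [|y ry [C HC]] :=
    @ode_extension R d (fun i => map_poly toR (p i)) f r ode f0 r0 Nroot.
  (* As [1 / y1 > l], almost all terms at [y] are at most 1, and the finitely many others are
     bounded by their sum. *)
  move=> y y0 yr; pose y1 := (y + r) / 2.
  have [yy1 y1r] : y < y1 /\ y1 < r by rewrite /y1; split; lra.
  have y1_gt0 : 0 < y1 by exact: le_lt_trans yy1.
  have lt_l : (limn_esup e < (y1^-1)%:E)%E.
    by rewrite El lte_fin -[l]invrK ltf_pV2 ?posrE.
  have [n0 Hn0] := limn_esup_lt lt_l.
  exists (1 + \sum_(i < n0.+1) f i * y ^+ i) => n.
  have sum0 m : 0 <= \sum_(i < m) f i * y ^+ i.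
    by apply: sumr_ge0 => i _; rewrite mulr_ge0 // exprn_ge0.
  have [lt_n|le_n] := ltnP n n0.+1.
    rewrite (bigD1 (Ordinal lt_n)) //= addrCA lerDl addr_ge0 //.
    by apply: sumr_ge0 => i _; rewrite mulr_ge0 // exprn_ge0.
  apply: (@le_trans _ _ 1); last by rewrite lerDl.
  have n_gt0 : (0 < n)%N by exact: leq_ltn_trans le_n.
  have y1V : 0 <= y1^-1 by rewrite invr_ge0 ltW.
  have := Hn0 n (ltnW le_n); rewrite (root_le _ _ n_gt0 y1V) exprVn => Hn; apply: (@le_trans _ _ ((y1 ^+ n)^-1 * y1 ^+ n)).
    by apply: ler_pM => //; [exact: exprn_ge0|rewrite lerXn2r // ?nnegrE // ltW].
  by rewrite mulVf // expf_neq0 // gt_eqF.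
(* Powers of [y / y1] absorb the constant [C], which bounds the limit superior by [1 / y1 < l]. *)
pose y1 := (r + y) / 2; have [ry1 y1y] : r < y1 /\ y1 < y by rewrite /y1; split; lra.
have y1_gt0 : 0 < y1 by exact: lt_trans ry1.
have q1 : 1 < y / y1 by rewrite ltr_pdivlMr // mul1r.
have [n0 Hn0] := exprn_unbounded C q1.
have : (limn_esup e <= (y1^-1)%:E)%E.
  apply: (@limn_esup_le _ _ _ n0.+1) => n le_n.
  have n_gt0 : (0 < n)%N by exact: leq_ltn_trans le_n.
  have y1V : 0 <= y1^-1 by rewrite invr_ge0 ltW.
  rewrite (root_le _ _ n_gt0 y1V).
  have yn : 0 < y ^+ n by rewrite exprn_gt0 // (lt_trans y1_gt0).
  rewrite -(ler_pM2r yn); apply: le_trans (HC n) _.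
  by apply: le_trans (Hn0 n (ltnW le_n)) _; rewrite expr_div_n exprVn mulrC.
by rewrite El lee_fin leNgt -[l]invrK ltf_pV2 ?posrE // ry1.
Qed.

End Growth.

Theorem corollary3p3 (R : realType) (N : nat) (hN : (1 <= N)%N) :
  [/\ D_finite (fun n => (count_identity (bs_rel N) n)%:R : rat),
      D_finite (fun n => (count_reduced_identity (bs_rel N) n)%:R : rat) &
      exists2 x : R, algebraicOver (ratr : rat -> R) x
                   & cogrowth R (bs_rel N) = x%:E].
Proof.
have red := count_reduced_identity_D_finite hN.
split; [exact: count_identity_D_finite|exact: red|].
(* The growth bound is the number [4 ^ n] of all words of length [n]. *)
apply: (D_finite_growth_algebraic (B := #|{: letter bs_gen}|) R red) => n.
by rewrite -card_tuple; exact: max_card.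
Qed.
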